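(* Let $V^-$ and $V^+$ be the lower and upper value functions of the differential game described in the context. Then $V^-$ is a viscosity solution on $\mathbb{R}^n$ of $$\min\Big\{\gamma V(\bm{x})-H^-\Big(\bm{x},\frac{\partial V(\bm{x})}{\partial\bm{x}}\Big),\ V(\bm{x})-h(\bm{x})\Big\}=0,$$ and $V^+$ is a viscosity solution on $\mathbb{R}^n$ of $$\min\Big\{\gamma V(\bm{x})-H^+\Big(\bm{x},\frac{\partial V(\bm{x})}{\partial\bm{x}}\Big),\ V(\bm{x})-h(\bm{x})\Big\}=0,$$ where $H^-(\bm{x},\bm{p})=\sup_{\bm{d}\in D}\inf_{\bm{u}\in U}\bm{p}\cdot\bm{f}(\bm{x},\bm{u},\bm{d})$ and $H^+(\bm{x},\bm{p})=\inf_{\bm{u}\in U}\sup_{\bm{d}\in D}\bm{p}\cdot\bm{f}(\bm{x},\bm{u},\bm{d})$.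
   Context: Setting. $U\subset\mathbb{R}^m$ and $D\subset\mathbb{R}^l$ are compact. $\bm{f}:\mathbb{R}^n\times U\times D\to\mathbb{R}^n$ is continuous in $(\bm{x},\bm{u},\bm{d})$ and locally Lipschitz in $\bm{x}$ uniformly in $(\bm{u},\bm{d})\in U\times D$. $\mathcal{U}$ is the set of measurable functions $\bm{u}(\cdot):[0,\infty)\to U$, and $\mathcal{D}$ is the set of measurable functions $\bm{d}(\cdot):[0,\infty)\to D$. For $\bm{x}\in\mathbb{R}^n$, $\bm{u}(\cdot)\in\mathcal{U}$, $\bm{d}(\cdot)\in\mathcal{D}$, $\bm{\phi}_{\bm{x}}^{\bm{u},\bm{d}}:[0,\infty)\to\mathbb{R}^n$ denotes the (Carathéodory) solution of $\dot{\bm{x}}(s)=\bm{f}(\bm{x}(s),\bm{u}(s),\bm{d}(s))$ with $\bm{\phi}_{\bm{x}}^{\bm{u},\bm{d}}(0)=\bm{x}$; it is assumed to exist on all of $[0,\infty)$ and to be unique. Non-anticipative strategies. $\Gamma$ is the set of maps $\bm{\alpha}(\cdot):\mathcal{D}\to\mathcal{U}$ such that for every $s\ge 0$ and all $\bm{d}_1,\bm{d}_2\in\mathcal{D}$ with $\bm{d}_1(t)=\bm{d}_2(t)$ for a.e. $t\in[0,s]$, one has $\bm{\alpha}(\bm{d}_1)(t)=\bm{\alpha}(\bm{d}_2)(t)$ for a.e. $t\in[0,s]$. $\Delta$ is the analogously defined set of non-anticipative maps $\bm{\beta}(\cdot):\mathcal{U}\to\mathcal{D}$. Value functions. $h:\mathbb{R}^n\to\mathbb{R}$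 is bounded and locally Lipschitz, $\gamma\in(0,\infty)$ is fixed, $J(\bm{x},\bm{u},\bm{d})=\sup_{t\in[0,\infty)}e^{-\gamma t}h(\bm{\phi}_{\bm{x}}^{\bm{u},\bm{d}}(t))$, $$V^-(\bm{x})=\inf_{\bm{\alpha}\in\Gamma}\sup_{\bm{d}\in\mathcal{D}}J(\bm{x},\bm{\alpha}(\bm{d}),\bm{d}),\qquad V^+(\bm{x})=\sup_{\bm{\beta}\in\Delta}\inf_{\bm{u}\in\mathcal{U}}J(\bm{x},\bm{u},\bm{\beta}(\bm{u})).$$ Viscosity solutions. For $H\in\{H^-,H^+\}$, a locally bounded continuous function $V$ on $\mathbb{R}^n$ is a viscosity solution of $\min\{\gamma V-H(\bm{x},\partial V/\partial\bm{x}),V-h\}=0$ if: (1) (supersolution) for every $v\in C^\infty(\mathbb{R}^n)$ such that $V-v$ attains a local minimum at $\bm{x}_0$, $\min\{\gamma V(\bm{x}_0)-H(\bm{x}_0,\frac{\partial v}{\partial\bm{x}}(\bm{x}_0)),\,V(\bm{x}_0)-h(\bm{x}_0)\}\ge0$; and (2) (subsolution) for every $v\in C^\infty(\mathbb{R}^n)$ such that $V-v$ attains a local maximum at $\bm{x}_0$, $\min\{\gamma V(\bm{x}_0)-H(\bm{x}_0,\frac{\partial v}{\partial\bm{x}}(\bm{x}_0)),\,V(\bm{x}_0)-h(\bm{x}_0)\}\le0$. *)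

(* Defs.v *)
From HB Require Import structures.
From mathcomp Require Import all_boot all_order all_algebra.
From mathcomp Require Import all_classical all_reals all_analysis.
From mathcomp Require Import measurable_realfun.

Set Implicit Arguments.
Unset Strict Implicit.
Unset Printing Implicit Defensive.

Import Order.TTheory GRing.Theory Num.Theory.
Import numFieldNormedType.Exports.

Local Open Scope classical_set_scope.
Local Open Scope ring_scope.

(* Functions on [0, +oo[ are encoded as total functions on R, whose values at
   negative times are junk: no definition below depends on them, except that a
   strategy receives (and returns) the total function.  Non-anticipativity
   forces the output of a strategy on [0, +oo[ to be independent, up to a null
   set, of the values of its argument at negative times.
   R^n is 'rV[R]_n with its library (sup) norm. *)

Section Regularity.
Context {R : realType}.

Definition locally_lipschitz {V W : normedModType R} (g : V -> W) : Prop :=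
  forall x0 : V, exists k : R, exists2 N, nbhs x0 N & k.-lipschitz_N g.

(* The neighbourhood and the constant do not depend on (u, d) in U x D. *)
Definition locally_lipschitz_uniformly {V W : normedModType R} {S T : Type}
    (U : set S) (D : set T) (f : V -> S -> T -> W) : Prop :=
  forall x0 : V, exists k : R, exists2 N, nbhs x0 N &
    forall u d, U u -> D d -> k.-lipschitz_N (fun x => f x u d).

Definition partial n (i : 'I_n) (v : 'rV[R]_n -> R) : 'rV[R]_n -> R :=
  fun x => 'D_(delta_mx 0 i) v x.

Definition iter_partial n (s : seq 'I_n) (v : 'rV[R]_n -> R) :
    'rV[R]_n -> R :=
  foldr (@partial n) v s.

(* C^oo: partial derivatives of all orders exist and are continuous. *)
Definition smooth n (v : 'rV[R]_n -> R) : Prop :=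
  forall s : seq 'I_n,
    continuous (iter_partial s v) /\
    forall (i : 'I_n) x, derivable (iter_partial s v) x (delta_mx 0 i).

Definition gradient n (v : 'rV[R]_n -> R) (x : 'rV[R]_n) : 'rV[R]_n :=
  \row_i partial i v x.

Definition dotp n (p q : 'rV[R]_n) : R := \sum_(i < n) p 0 i * q 0 i.

Definition abs_continuous_on {W : normedModType R} (a b : R) (y : R -> W) :
    Prop :=
  forall e : R, 0 < e -> exists2 r : R, 0 < r &
    forall (k : nat) (s t : 'I_k -> R),
      (forall i, a <= s i /\ s i <= t i /\ t i <= b) ->
      trivIset setT (fun i => `]s i, t i[%classic) ->
      \sum_(i < k) (t i - s i) < r ->
      \sum_(i < k) `|y (t i) - y (s i)| < e.

End Regularity.

Section DifferentialGame.
Context {R : realType}.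

Notation leb := (@lebesgue_measure R).

(* Measurability is from R with its Lebesgue (completed Borel) sigma-algebra to
   R^k with its Borel sigma-algebra. *)
Definition signals k (A : set 'rV[R]_k) : set (R -> 'rV[R]_k) :=
  [set a | (forall t : R, 0 <= t -> A (a t)) /\
     measurable_fun
       (`[0, +oo[%classic : set (g_sigma_algebraType (completed_algebra_gen leb)))
       (a : _ -> g_sigma_algebraType (@open 'rV[R]_k))].

Definition ae_equal_until (T : Type) (s : R) (a b : R -> T) : Prop :=
  {ae leb, forall t : R, 0 <= t <= s -> a t = b t}.

Definition strategies k j (A : set 'rV[R]_k) (B : set 'rV[R]_j) :
    set ((R -> 'rV[R]_k) -> (R -> 'rV[R]_j)) :=
  [set al | (forall a, signals A a -> signals B (al a)) /\
     forall s a1 a2, 0 <= s -> signals A a1 -> signals A a2 ->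
       ae_equal_until s a1 a2 -> ae_equal_until s (al a1) (al a2)].

Context {n m l : nat}.
Implicit Types (x p : 'rV[R]_n) (u : R -> 'rV[R]_m) (d : R -> 'rV[R]_l).
Implicit Types (U : set 'rV[R]_m) (D : set 'rV[R]_l) (h V : 'rV[R]_n -> R).
Implicit Types (f : 'rV[R]_n -> 'rV[R]_m -> 'rV[R]_l -> 'rV[R]_n).

Definition caratheodory_solution f x u d (y : R -> 'rV[R]_n) : Prop :=
  [/\ y 0 = x,
      forall T : R, 0 <= T -> abs_continuous_on 0 T y &
      {ae leb, forall t : R, 0 < t -> is_derive t (1 : R) y (f (y t) (u t) (d t))}].

Definition solution_flow U D f
    (phi : 'rV[R]_n -> (R -> 'rV[R]_m) -> (R -> 'rV[R]_l) -> R -> 'rV[R]_n) :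
    Prop :=
  forall x u d, signals U u -> signals D d ->
    caratheodory_solution f x u d (phi x u d) /\
    forall y, caratheodory_solution f x u d y ->
      forall t, 0 <= t -> y t = phi x u d t.

Implicit Types
  (phi : 'rV[R]_n -> (R -> 'rV[R]_m) -> (R -> 'rV[R]_l) -> R -> 'rV[R]_n).

Definition payoff phi h (gamma : R) x u d : R :=
  sup [set expR (- gamma * t) * h (phi x u d t) | t in `[0, +oo[%classic].

(* When h is bounded and U, D are nonempty, all the real suprema and infima
   below are those of nonempty bounded sets. *)
Definition lower_value U D phi h gamma x : R :=
  inf [set sup [set payoff phi h gamma x (al d) d | d in signals D]
      | al in strategies D U].

Definition upper_value U D phi h gamma x : R :=
  sup [set inf [set payoff phi h gamma x u (be u) | u in signals U]
      | be in strategies U D].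

Definition lower_hamiltonian U D f x p : R :=
  sup [set inf [set dotp p (f x u d) | u in U] | d in D].

Definition upper_hamiltonian U D f x p : R :=
  inf [set sup [set dotp p (f x u d) | d in D] | u in U].

Definition viscosity_supersolution (gamma : R) (H : 'rV[R]_n -> 'rV[R]_n -> R)
    h V : Prop :=
  forall (v : 'rV[R]_n -> R) x0, smooth v ->
    (\forall x \near x0, V x0 - v x0 <= V x - v x) ->
    0 <= Num.min (gamma * V x0 - H x0 (gradient v x0)) (V x0 - h x0).

Definition viscosity_subsolution (gamma : R) (H : 'rV[R]_n -> 'rV[R]_n -> R)
    h V : Prop :=
  forall (v : 'rV[R]_n -> R) x0, smooth v ->
    (\forall x \near x0, V x - v x <= V x0 - v x0) ->
    Num.min (gamma * V x0 - H x0 (gradient v x0)) (V x0 - h x0) <= 0.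

Definition viscosity_solution (gamma : R) (H : 'rV[R]_n -> 'rV[R]_n -> R)
    h V : Prop :=
  [/\ [locally [bounded V x | x in setT]],
      continuous V,
      viscosity_supersolution gamma H h V &
      viscosity_subsolution gamma H h V].

End DifferentialGame.

(* Main.v *)
Require Import Defs.
From HB Require Import structures.
From mathcomp Require Import all_boot all_order all_algebra.
From mathcomp Require Import all_classical all_reals all_analysis.
From mathcomp Require Import measurable_realfun.
From mathcomp Require Import ring lra.
Import Order.TTheory GRing.Theory Num.Theory.
Import numFieldNormedType.Exports.
Local Open Scope classical_set_scope.
Local Open Scope ring_scope.
Set Implicit Arguments.
Unset Strict Implicit.
Unset Printing Implicit Defensive.

(** Both value functions are handled by dynamic programming, and each of the
four viscosity inequalities needs only one half of the dynamic programming
principle.  One half is obtained by letting the player who acts first use a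
constant control on a short interval [0, tau] and by restarting the opponent's
strategy at time tau ([game_value_ge_open_loop]).  The other half is obtained
by letting the player with strategies follow a prescribed strategy on
[0, tau] and then a nearly optimal strategy for the state reached at time tau
([game_value_le_strategy]); that state depends on the opponent's past only, so
the glued map is non-anticipative whatever choice of nearly optimal strategies
is made.  Replacing the payoff by its opposite exchanges the two players, so
both halves serve both values ([lower_dpp_ge], [lower_dpp_le],
[upper_dpp_ge], [upper_dpp_le]).

If the value V fails to be a supersolution at x0, with test function v and
p its gradient at x0, then H(x0, p) > gamma V(x0): the maximizing player has
a constant control, or a selection of controls against each control of the
opponent, along which p . f >= gamma V(x0) + theta.  Then discounted V
increases by a definite amount over a short time ([local_increase]), against
dynamic programming.  If V fails to be a subsolution, then V(x0) > h(x0) and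
the minimizing player makes discounted V decrease ([local_decrease]) before
the discounted obstacle can come close to V(x0) ([local_obstacle]).  The
selections take finitely many values, by compactness of the control sets
([finite_borel_selection]), so that they turn signals into signals.

Continuity of the values is the point where global existence of trajectories
enters.  It follows from a Gronwall estimate that is uniform over all
controls, provided that the states reached in bounded time from a
neighbourhood of a point form a bounded set ([reach_bounded]).  Each single
trajectory is bounded on bounded time intervals, but the velocity sets need
not be convex, so the reachable sets need not be closed and uniformity is not
a matter of extracting limits of controls.  Suppose that trajectories from
near x reach arbitrarily large states before time s.  Then there are points
y 0 = x, y 1, y 2, ... with |y k| unbounded, such that each y (k+1) is reached
from points arbitrarily close to y k, in steps of total duration at most s
([blow_up_chain]).  As the flow over a fixed time is an open map of the
initial state, for each fixed control, nested balls of initial states then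
produce one initial state and one control whose trajectory passes within
distance 1 of every y k ([chain_shadowing]): it is unbounded in finite time,
which is impossible.  Openness of the flow amounts to solving the equation
backwards in time, and over a short time this is the fixed point problem of a
contraction ([flow_onto]).

The calculus of Caratheodory solutions rests on [ac_nonincreasing]: an
absolutely continuous function whose increments are almost everywhere locally
nonpositive to first order is nonincreasing. *)

(** * Absolutely continuous functions *)

Section AbsoluteContinuity.
Context {R : realType}.
Notation leb := (@lebesgue_measure R).

(** The step hypothesis carries S across the supremum of the points where S holds,
    so this supremum can only be b. *)
Lemma real_induction (a b : R) (S : R -> Prop) : a <= b -> S a ->
  (forall t, a <= t <= b -> exists2 r, 0 < r & forall s1 s2,
     a <= s1 -> s1 <= t <= s2 -> s2 <= b -> s2 - s1 < r -> S s1 -> S s2) ->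
  S b.
Proof.
move=> ab Sa H; pose E := [set t | a <= t <= b /\ S t].
have Ea : E a by split; rewrite ?lexx.
have supE : has_sup E.
  by split; [exists a|exists b => t [/andP[]]].
have ca : a <= sup E by apply: ub_le_sup => //; case: supE.
have cb : sup E <= b by apply: ge_sup; [exists a|move=> t [/andP[]]].
have [r r0 Hr] := H (sup E) (introT andP (conj ca cb)).
have r20 : 0 < r / 2 by rewrite divr_gt0.
have [s1 [/andP[as1 s1b] Ss1] s1c] := sup_adherent r20 supE.
have s1le : s1 <= sup E by apply: ub_le_sup; [case: supE|split => //; apply/andP].
have [bc|bc] := leP b (sup E + r / 2).
  by apply: (Hr s1 b) => //; [rewrite s1le|lra].
have Ss2 : S (sup E + r / 2).
  by apply: (Hr s1 _) => //; [rewrite s1le; lra|exact: ltW|lra].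
have : sup E + r / 2 <= sup E.
  by apply: ub_le_sup; [case: supE|split => //; apply/andP; split; lra].
by move=> ?; exfalso; lra.
Qed.

Lemma negligible_open_cover (N : set R) (e : R) : leb.-negligible N -> 0 < e ->
  exists Q : set R, [/\ open Q, N `<=` Q & (leb Q < e%:E)%E].
Proof.
move=> [A [mA A0 NA]] e0.
have [|Q [oQ AO Qe]] := lebesgue_regularity_outer mA _ e0.
  by rewrite [X in (X < _)%E](_ : _ = 0%E).
exists Q; split => //; first exact: (subset_trans NA).
apply: le_lt_trans Qe; rewrite -[in leLHS](setDUK AO) measureU//=.
- by rewrite [X in (X + _)%E](_ : _ = 0%E) ?add0e.
- by apply: measurableD => //; exact: open_measurable.
- by rewrite setDE setICA setICr setI0.
Qed.

Lemma ae_imply (P Q : R -> Prop) : (forall t, P t -> Q t) ->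
  {ae leb, forall t, P t} -> {ae leb, forall t, Q t}.
Proof. by move=> PQ; apply: negligibleS => t /= nQ /PQ. Qed.

Lemma ae_imply2 (P1 P2 Q : R -> Prop) : (forall t, P1 t -> P2 t -> Q t) ->
  {ae leb, forall t, P1 t} -> {ae leb, forall t, P2 t} ->
  {ae leb, forall t, Q t}.
Proof.
move=> PQ ae1 ae2; apply: negligibleS (negligibleU ae1 ae2) => t /= nQ.
by apply: contrapT => /not_orP[/contrapT p1 /contrapT p2]; exact/nQ/PQ.
Qed.

Lemma ae_neq (a : R) : {ae leb, forall t, t <> a}.
Proof.
apply: (@negligibleS _ _ _ leb [set a]) => [t /contrapT//|].
by apply/negligibleP; [exact: measurable_set1|exact: lebesgue_measure_set1].
Qed.

Lemma measurable_translate (c : R) (A : set R) : measurable A ->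
  measurable [set t : R | A (c + t)].
Proof.
move=> mA; have -> : [set t : R | A (c + t)] = setT `&` (fun t => c + t) @^-1` A.
  by rewrite setTI.
have mf : measurable_fun setT (fun t : R => c + t).
  by apply: measurable_funD.
exact: mf.
Qed.

Lemma lebesgue_measure_translate (c : R) (A : set R) : measurable A ->
  leb [set t | A (c + t)] = leb A.
Proof.
have mf : measurable_fun setT ((fun t : R => c + t) : measurableTypeR R -> measurableTypeR R).
  by apply: measurable_funD.
pose f : {mfun measurableTypeR R >-> measurableTypeR R} :=
   HB.pack ((fun t : R => c + t) : measurableTypeR R -> measurableTypeR R)
     (isMeasurableFun.Build _ _ _ _ _ mf).
move=> mA; rewrite -[LHS]/(pushforward leb f A).
apply/esym/lebesgue_measure_unique => //= _ [[a b]] _ <-.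
rewrite /pushforward (_ : _ @^-1` _ = `](a - c), (b - c)]%classic).
  rewrite !lebesgue_measure_itv/= !lte_fin ltrD2r; case: ifP => // _.
  by rewrite -!EFinD; congr _%:E; ring.
apply/seteqP; split => t /=; rewrite !in_itv/=; lra.
Qed.

Lemma negligible_translate (c : R) (N : set R) : leb.-negligible N ->
  leb.-negligible [set t | N (c + t)].
Proof.
move=> [A [mA A0 NA]]; exists [set t | A (c + t)]; split => //.
- exact: measurable_translate.
- by rewrite lebesgue_measure_translate.
- by move=> t /NA.
Qed.

Lemma ae_translate (c : R) (P : R -> Prop) : {ae leb, forall t, P t} ->
  {ae leb, forall t, P (c + t)}.
Proof. exact: negligible_translate. Qed.

Lemma lebesgue_open_extend (Q : set R) (s1 s2 : R) : open Q -> s1 <= s2 ->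
  `]s1, s2[ `<=` Q ->
  (leb (Q `&` `]-oo, s1[) + (s2 - s1)%:E <= leb (Q `&` `]-oo, s2[))%E.
Proof.
move=> oQ s12 sO.
have -> : (s2 - s1)%:E = leb `]s1, s2[.
  by rewrite lebesgue_measure_itv/= lte_fin; case: ltgtP s12 => // ->; rewrite subrr.
rewrite -measureU//=; first 1 last.
- by apply: measurableI => //; exact: open_measurable.
- apply/seteqP; split => // x [[_ /=]]; rewrite !in_itv/= => xs /andP[sx _].
  by have := lt_trans xs sx; rewrite ltxx.
apply: le_measure; rewrite ?inE.
- by apply: measurableU => //; apply: measurableI => //; exact: open_measurable.
- by apply: measurableI => //; exact: open_measurable.
move=> x [[Ox xs]|xs].
  split => //; move: xs; rewrite /= !in_itv/= => xs.
  by rewrite (lt_le_trans xs).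
by split; [exact: sO|move: xs; rewrite /= !in_itv/= => /andP[]].
Qed.

(** Outside a null set the increments are small by hypothesis; the null set is
    covered by an open set Q so small that absolute continuity bounds the
    increments over intervals lying in Q.  Real induction adds up both kinds of
    increments, and carries along the list of the intervals used inside Q.  The
    hypothesis is on increments and not on a derivative because the lemma is
    applied to functions such as the norm of y t - y a minus M t, which need not
    be differentiable where y is. *)
Lemma ac_nonincreasing (g : R -> R) a b : a <= b -> abs_continuous_on a b g ->
  {ae leb, forall t, a < t < b -> forall e : R, 0 < e -> exists2 r : R, 0 < r &
     forall s1 s2, s1 <= t <= s2 -> s2 - s1 < r -> a <= s1 -> s2 <= b ->
       g s2 - g s1 <= e * (s2 - s1)} ->
  g b <= g a.
Proof.
move=> ab acg aeg; apply/ler_addgt0Pr => e0 e0gt.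
(* the regular points contribute at most e (b - a), the null set at most e *)
pose e := e0 / (b - a + 1).
have ba1 : 0 < b - a + 1 by lra.
have egt : 0 < e by rewrite divr_gt0.
have -> : e0 = e * (b - a) + e by rewrite -[in RHS](mulr1 e) -mulrA mul1r -mulrDr divfK ?gt_eqF.
have [r r0 Hr] := acg e egt.
have neg : leb.-negligible ([set t | ~ (a < t < b -> forall e : R, 0 < e ->
     exists2 r : R, 0 < r &
     forall s1 s2, s1 <= t <= s2 -> s2 - s1 < r -> a <= s1 -> s2 <= b ->
       g s2 - g s1 <= e * (s2 - s1))] `|` ([set a] `|` [set b])).
  by apply: negligibleU => //; apply: negligibleU;
     (apply/negligibleP; [exact: measurable_set1|exact: lebesgue_measure_set1]).
have [Q [oQ NQ Qr]] := negligible_open_cover neg r0.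
pose S t := exists l : seq (R * R), [/\
  all (fun p => (a <= p.1 <= p.2) && (p.2 <= t)) l,
  pairwise (fun p q => q.2 <= p.1) l,
  ((\sum_(p <- l) (p.2 - p.1))%:E <= leb (Q `&` `]-oo, t[))%E &
  g t - g a <= e * (t - a) + \sum_(p <- l) `|g p.2 - g p.1| ].
(* at b the intervals of the list have total length less than r *)
suff [l [la lp lQ lg]] : S b.
  suff : \sum_(p <- l) `|g p.2 - g p.1| < e by lra.
  rewrite big_tnth.
  apply: (Hr (size l) (fun i => (tnth (in_tuple l) i).1)
                   (fun i => (tnth (in_tuple l) i).2)).
  - move=> i; have /andP[/andP[? ?] ?] := allP la _ (mem_tnth i (in_tuple l)).
    by [].
  - apply/trivIsetP => i j _ _ ij.
    wlog ltij : i j ij / (i < j)%N.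
      move=> H; case: (ltngtP i j) => [||/val_inj] ; [exact: H| |].
        by rewrite setIC => ?; apply: H => //; rewrite eq_sym.
      by move=> eij; rewrite eij eqxx in ij.
    apply/seteqP; split => // x []; rewrite /= !in_itv/= => /andP[xi _] /andP[_ xj].
    move/(pairwiseP (0, 0)): lp => /(_ i j).
    rewrite !inE => /(_ (ltn_ord i) (ltn_ord j) ltij).
    rewrite -[nth _ _ i](tnth_nth _ (in_tuple l)) -[nth _ _ j](tnth_nth _ (in_tuple l)).
    by move=> /(lt_le_trans (lt_trans xi xj)); rewrite ltxx.
  - rewrite -lte_fin -(big_tnth _ _ l xpredT (fun p => p.2 - p.1)).
    apply: le_lt_trans Qr; apply: le_trans lQ _.
    apply: le_measure; rewrite ?inE; [|exact: open_measurable|by move=> ? []].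
    by apply: measurableI => //; exact: open_measurable.
apply: (@real_induction a b S ab).
  by exists [::]; rewrite /= !big_nil !subrr mulr0 addr0; split.
move=> t /andP[at_ tb].
(* a point of Q: the whole interval [s1, s2] is added to the list *)
have [tN|tN] := pselect (Q t).
  have [r1 /= r1gt r1Q] := (nbhs_ballP _ _).1 (open_nbhs_nbhs (conj oQ tN)).
  exists r1 => // s1 s2 as1 /andP[s1t ts2] s2b s12 [l [la lp lQ lg]].
  have s1s2 : s1 <= s2 by exact: le_trans ts2.
  exists ((s1, s2) :: l); split => /=.
  - rewrite as1 s1s2 lexx /=; apply: sub_all la => p /andP[-> /=].
    by move=> /le_trans; exact.
  - by rewrite lp andbT; apply: sub_all la => p /andP[_].
  - rewrite big_cons/= EFinD addeC; apply: le_trans (lebesgue_open_extend oQ s1s2 _).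
      by apply: leeD.
    move=> x; rewrite /= in_itv/= => /andP[s1x xs2]; apply: r1Q.
    by rewrite -ball_normE/= ltr_norml; lra.
  - rewrite big_cons/=.
    have := ler_norm (g s2 - g s1).
    have : e * (s1 - a) <= e * (s2 - a) by rewrite ler_pM2l//; lra.
    lra.
have tab : a < t < b.
  rewrite !lt_neqAle at_ tb !andbT; apply/andP.
  by split; apply/eqP => tE; apply: tN; apply: NQ; right;
    [left|right]; rewrite /= tE.
have /contrapT/(_ tab e egt)[r1 r1gt Hr1] : ~ ~ _ := fun H => tN (NQ _ (or_introl H)).
exists r1 => // s1 s2 as1 s1ts2 s2b s12 [l [la lp lQ lg]].
have s1s2 : s1 <= s2 by move/andP : s1ts2 => [] /le_trans; exact.
exists l; split => //.
- by apply: sub_all la => p /andP[-> /=] /le_trans; exact.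
- apply: le_trans lQ _; apply: le_measure; rewrite ?inE.
  + by apply: measurableI => //; exact: open_measurable.
  + by apply: measurableI => //; exact: open_measurable.
  + move=> x [Ox xs]; split => //; move: xs; rewrite /= !in_itv/= => xs.
    by rewrite (lt_le_trans xs).
- have := Hr1 s1 s2 s1ts2 s12 as1 s2b; lra.
Qed.

Lemma ac_sub (W : normedModType R) (y : R -> W) (a b a' b' : R) :
  a <= a' -> b' <= b -> abs_continuous_on a b y -> abs_continuous_on a' b' y.
Proof.
move=> aa bb acy e /acy[r r0 Hr]; exists r => // k s t st; apply: Hr => i.
by have [? [? ?]] := st i; split; [exact: (le_trans aa)|split => //; exact: le_trans bb].
Qed.

Lemma ac_translate (W : normedModType R) (y : R -> W) (a b c : R) :
  abs_continuous_on (c + a) (c + b) y ->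
  abs_continuous_on a b (fun t => y (c + t)).
Proof.
move=> acy e /acy[r r0 Hr]; exists r => // k s t st triv sumr.
apply: (Hr k (fun i => c + s i) (fun i => c + t i)).
- by move=> i; have [? [? ?]] := st i; rewrite !lerD2l.
- apply/trivIsetP => i j _ _ ij; move/trivIsetP : triv => /(_ i j I I ij).
  apply: contraPP => /eqP/set0P[x [/=]]; rewrite !in_itv/= => xi xj.
  apply/eqP/set0P; exists (x - c); split; rewrite /= in_itv/=; lra.
- by apply: le_lt_trans sumr; apply: ler_sum => i _; lra.
Qed.

(** All the absolutely continuous functions needed here are Lipschitz expressions
    in one or two given ones and in time, so this single criterion replaces
    separate closure properties. *)
Lemma ac_dominated (W1 W2 W3 : normedModType R) (y1 : R -> W1) (y2 : R -> W2)
    (g : R -> W3) (a b C : R) : 0 < C ->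
  abs_continuous_on a b y1 -> abs_continuous_on a b y2 ->
  (forall s t, a <= s -> s <= t -> t <= b ->
     `|g t - g s| <= C * (`|y1 t - y1 s| + `|y2 t - y2 s| + (t - s))) ->
  abs_continuous_on a b g.
Proof.
move=> C0 ac1 ac2 H e e0.
have e3 : 0 < e / (3 * C) by rewrite divr_gt0// mulr_gt0.
have [r1 r10 H1] := ac1 _ e3; have [r2 r20 H2] := ac2 _ e3.
exists (Num.min (Num.min r1 r2) (e / (3 * C))) => [|k s t st triv].
  by rewrite !lt_min r10 r20.
rewrite !lt_min => /andP[/andP[/(H1 k s t st triv) h1 /(H2 k s t st triv) h2] h3].
apply: (@le_lt_trans _ _ (\sum_(i < k) C * (`|y1 (t i) - y1 (s i)| +
   `|y2 (t i) - y2 (s i)| + (t i - s i)))).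
  by apply: ler_sum => i _; have [? [? ?]] := st i; exact: H.
rewrite -mulr_sumr big_split/= [X in X + _]big_split/=.
have -> : e = C * (e / (3 * C) + e / (3 * C) + e / (3 * C)).
  by field; rewrite gt_eqF.
by rewrite ltr_pM2l//; apply: ltrD => //; exact: ltrD.
Qed.

Lemma ac_unif_continuous (W : normedModType R) (y : R -> W) (a b e : R) :
  abs_continuous_on a b y -> 0 < e -> exists2 r, 0 < r &
  forall s t, a <= s -> s <= t -> t <= b -> t - s < r -> `|y t - y s| < e.
Proof.
move=> acy /acy[r r0 Hr]; exists r => // s t as_ st tb tsr.
have := Hr 1%N (fun=> s) (fun=> t) _ _ _; rewrite !big_ord1; apply => //.
by apply/trivIsetP => i j _ _; rewrite !ord1 eqxx.
Qed.

(** Real induction moves across t from s1 to s2, so the derivative is used on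
    intervals that contain t, not only on those that start at t. *)
Lemma is_derive_straddle (W : normedModType R) (y : R -> W) (t : R) dy e :
  is_derive t 1 y dy -> 0 < e -> exists2 r, 0 < r & forall s1 s2,
   s1 <= t <= s2 -> s2 - s1 < r ->
   `|y s2 - y s1 - (s2 - s1) *: dy| <= e * (s2 - s1).
Proof.
move=> [dy1 dy2] e0.
have : h^-1 *: (y (h + t) - y t) @[h --> 0^'] --> dy.
  move: dy1; rewrite /derivable => dy1.
  rewrite -dy2 /derive.
  under eq_fun do rewrite -{1}[X in y (X + _)](mulr1) -[_ * 1]/(_ *: (1 : R^o)).
  exact: dy1.
move/cvgrPdist_le => /(_ e e0) /nbhs_ballP[r /= r0 Hr].
have one h : `|h| < r -> `|y (h + t) - y t - h *: dy| <= e * `|h|.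
  have [->|h0] := eqVneq h 0.
    by rewrite add0r subrr sub0r scale0r oppr0 !normr0 mulr0.
  move=> hr; have := Hr h; rewrite -ball_normE /= sub0r normrN => /(_ hr h0).
  rewrite -(ler_pM2r (_ : 0 < `|h|)) ?normr_gt0// [_ * `|h|]mulrC -normrZ.
  by rewrite scalerBr scalerA mulfV// scale1r distrC.
exists r => // s1 s2 /andP[s1t ts2] s12.
have h1 := one (s1 - t); have h2 := one (s2 - t).
rewrite !subrK in h1 h2.
have {}h1 := h1 (_ : _ < r); have {}h2 := h2 (_ : _ < r).
have n1 : `|s1 - t| = t - s1 by rewrite distrC ger0_norm // subr_ge0.
have n2 : `|s2 - t| = s2 - t by rewrite ger0_norm // subr_ge0.
rewrite n1 in h1; rewrite n2 in h2.
have -> : y s2 - y s1 - (s2 - s1) *: dy =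
  (y s2 - y t - (s2 - t) *: dy) - (y s1 - y t - (s1 - t) *: dy).
  have -> : s2 - s1 = (s2 - t) - (s1 - t) by ring.
  rewrite scalerBl -[in RHS](opprB (_ *: _)) [in RHS]opprB -/(_ - _).
  rewrite [in RHS]opprB [X in _ = _ + X]addrC addrACA opprB.
  by congr (_ + _); [rewrite opprB addrA subrK|rewrite addrC].
apply: le_trans (ler_normB _ _) _.
have := h1 (_ : t - s1 < r); have := h2 (_ : s2 - t < r).
have -> : e * (s2 - s1) = e * (s2 - t) + e * (t - s1) by ring.
move=> H2 H1; apply: lerD; [apply: H2|apply: H1]; lra.
Qed.

Lemma ac_increment_le (W : normedModType R) (y : R -> W) (a b M : R) :
  a <= b -> abs_continuous_on a b y ->
  {ae leb, forall t, a < t < b -> exists2 dy, is_derive t 1 y dy & `|dy| <= M} ->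
  `|y b - y a| <= M * (b - a).
Proof.
move=> ab acy aey.
pose g t := `|y t - y a| - M * t.
suff : g b <= g a by rewrite /g subrr normr0; lra.
apply: ac_nonincreasing => //.
  apply: (@ac_dominated _ _ _ y y g a b (1 + `|M|)) => //.
  move=> s t as_ st tb.
  have -> : g t - g s = (`|y t - y a| - `|y s - y a|) - M * (t - s).
    by rewrite /g; ring.
  apply: le_trans (ler_normB _ _) _; rewrite normrM.
  have -> : `|t - s| = t - s by rewrite ger0_norm // subr_ge0.
  have : `| `|y t - y a| - `|y s - y a| | <= `|y t - y s|.
    by apply: le_trans (ler_dist_dist _ _) _; rewrite opprB addrA subrK.
  have := normr_ge0 (y t - y s); have := normr_ge0 M.
  have : 0 <= `|M| * `|y t - y s| by rewrite mulr_ge0.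
  nra.
apply: ae_imply aey => t aet tab e e0.
have [dy dyt dyM] := aet tab.
have [r r0 Hr] := is_derive_straddle dyt e0.
exists r => // s1 s2 s1ts2 s12 as1 s2b.
have s1s2 : s1 <= s2 by move/andP : s1ts2 => [] /le_trans; exact.
have {}Hr := Hr _ _ s1ts2 s12.
have -> : g s2 - g s1 = (`|y s2 - y a| - `|y s1 - y a|) - M * (s2 - s1).
  by rewrite /g; ring.
have H1 : `|y s2 - y a| - `|y s1 - y a| <= `|y s2 - y s1|.
  by apply: le_trans (lerB_dist _ _) _; rewrite opprB addrA subrK.
have H2 : `|y s2 - y s1| <= e * (s2 - s1) + `|(s2 - s1) *: dy|.
  rewrite -lerBlDr; apply: le_trans Hr; exact: lerB_dist.
rewrite normrZ ger0_norm ?subr_ge0// in H2.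
have : (s2 - s1) * `|dy| <= M * (s2 - s1) by rewrite mulrC ler_wpM2r ?subr_ge0.
lra.
Qed.

End AbsoluteContinuity.

(** * Compactness *)

Section Compactness.
Context {R : realType}.

Lemma continuous_dist (V : normedModType R) (a : V) :
  continuous (fun x : V => `|x - a|).
Proof.
by move=> x; apply: cvg_norm; apply: cvgB; [exact: cvg_id|exact: cvg_cst].
Qed.

Lemma compact_rV_ball n (a : 'rV[R]_n) (r : R) :
  compact [set x : 'rV[R]_n | `|x - a| <= r].
Proof.
apply: bounded_closed_compact.
  exists (`|a| + r); split => [|M rM x /= xr]; first exact: num_real.
  have := ler_normD (x - a) a; rewrite subrK; lra.
have -> : [set x : 'rV[R]_n | `|x - a| <= r] =
  (fun x : 'rV[R]_n => `|x - a|) @^-1` [set z | z <= r] by [].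
apply: closed_comp; last exact: closed_le.
by move=> x _; exact: continuous_dist.
Qed.

(** Near each point a local Lipschitz constant is available; compactness gives a
    single k that works for all pairs at distance less than 1/k, and the bound M
    takes care of the other pairs. *)
Lemma lipschitz_on_compact (V W : normedModType R) (S T : Type)
    (U : set S) (D : set T) (g : V -> S -> T -> W) (K : set V) (M : R) :
  compact K -> locally_lipschitz_uniformly U D g ->
  (forall x u d, K x -> U u -> D d -> `|g x u d| <= M) ->
  exists2 L : R, 0 < L & forall x y u d, K x -> K y -> U u -> D d ->
    `|g x u d - g y u d| <= L * `|x - y|.
Proof.
move=> /compact_near_coveringP cK lg gM.
have [k k0 Hk] : exists2 k : R, 0 < k & forall x, K x -> forall y u d,
    U u -> D d -> `|x - y| < k^-1 -> `|g x u d - g y u d| <= k * `|x - y|.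
  pose P (k : R) (x : V) := forall y u d, U u -> D d -> `|x - y| < k^-1 ->
       `|g x u d - g y u d| <= k * `|x - y|.
  have FF : Filter (pinfty_nbhs R) by exact: _.
  have := cK R (pinfty_nbhs R) P FF.
  suff H : forall x, K x -> \forall x' \near x & i \near +oo, P i x'.
    move=> /(_ H) [k0 [_ Hk0]].
    exists (Num.max k0 0 + 1); first by rewrite ltr_pwDr// le_max lexx orbT.
    apply: (Hk0 (Num.max k0 0 + 1)).
    by apply: (@le_lt_trans _ _ (Num.max k0 0)); rewrite ?le_max ?lexx// ltrDl.
  move=> x0 _; have [k [N /nbhs_ballP[r /= r0 rN] Hk]] := lg x0.
  have r2 : 0 < r / 2 by rewrite divr_gt0.
  exists (ball x0 (r / 2), [set i | Num.max k (r / 2)^-1 < i]).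
    split => /=; first exact: nbhsx_ballx.
    by exists (Num.max k (r / 2)^-1); split => //; exact: num_real.
  move=> [x i] /= [xx0]; rewrite gt_max => /andP[ki ri] y u d Uu Dd xy.
  have i0 : 0 < i by apply: lt_trans ri; rewrite invr_gt0.
  have xy2 : `|x - y| < r / 2.
    by apply: (lt_trans xy); rewrite invf_plt// inE.
  have Nx : N x by apply: rN; apply: le_ball xx0; lra.
  have Ny : N y.
    apply: rN; rewrite [r]splitr; apply: ball_triangle xx0 _.
    by rewrite -ball_normE.
  apply: le_trans (Hk u d Uu Dd (x, y) (conj Nx Ny)) _ => /=.
  by rewrite ler_wpM2r// ltW.
exists (Num.max k (2 * M * k)) => [|x y u d Kx Ky Uu Dd].
  by rewrite lt_max k0.
have [xy|xy] := ltP `|x - y| k^-1.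
  apply: le_trans (Hk _ Kx _ _ _ Uu Dd xy) _.
  by rewrite ler_wpM2r// le_max lexx.
apply: le_trans (ler_normB _ _) _.
have := gM x u d Kx Uu Dd; have := gM y u d Ky Uu Dd.
have : 1 <= k * `|x - y| by rewrite -ler_pdivrMl// mulr1.
have : 2 * M * k * `|x - y| <= Num.max k (2 * M * k) * `|x - y|.
  by rewrite ler_wpM2r// le_max lexx orbT.
have := normr_ge0 (g y u d).
set a := `|x - y|; set b := Num.max _ _; set c := `|g y u d|; set e := `|g x u d|.
move=> c0 ab ka cM eM.
apply: le_trans ab; have : 2 * M <= 2 * M * (k * a) by rewrite ler_peMr//; lra.
lra.
Qed.

(** On the compact ball the distance from x to F x attains its minimum; it is at
    least halved when the minimizer is replaced by its image, so it vanishes. *)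
Lemma contraction_fixed_point (V : normedModType R) (a : V) (e : R) (F : V -> V) :
  0 <= e -> compact [set x : V | `|x - a| <= e] ->
  (forall x, `|x - a| <= e -> `|F x - a| <= e) ->
  (forall x y, `|x - a| <= e -> `|y - a| <= e -> `|F x - F y| <= 2^-1 * `|x - y|) ->
  exists2 x, `|x - a| <= e & F x = x.
Proof.
move=> e0; set K := [set x : V | `|x - a| <= e] => cK FB Flip.
have [] := @compact_EVT_min _ R (fun x => `|F x - x|) K _ cK.
- by exists a; rewrite /K /= subrr normr0.
- apply/subspace_continuousP => x Kx.
  apply/cvgrPdist_le => eps eps0; rewrite near_withinE.
  near=> y => Ky.
  have yx : `|x - y| <= eps / 2.
    near: y; apply: cvgr_dist_le; [exact: cvg_id|by rewrite divr_gt0].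
  apply: le_trans (ler_dist_dist _ _) _.
  have -> : F x - x - (F y - y) = (F x - F y) - (x - y).
    by rewrite !opprB addrACA [RHS]addrACA [X in _ = _ + X]addrC.
  apply: le_trans (ler_normB _ _) _.
  have := Flip x y Kx Ky; lra.
- move=> c; rewrite inE => Kc Hc; exists c => //.
  have := Hc (F c); rewrite inE => /(_ (FB _ Kc)).
  have := Flip (F c) c (FB _ Kc) Kc.
  move=> h1 h2; apply/eqP; rewrite -subr_eq0 -normr_le0.
  lra.
Unshelve. all: by end_near. Qed.

End Compactness.

(** * Measurable signals and selections *)

Section Signals.
Context {R : realType} {k : nat}.
Implicit Types (A : set 'rV[R]_k) (a b w : R -> 'rV[R]_k).
Notation leb := (@lebesgue_measure R).
Notation LT := (g_sigma_algebraType (completed_algebra_gen leb)).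

Lemma lebesgue_measurable_borel (E : set R) : measurable E ->
  measurable (E : set LT).
Proof.
move=> mE; apply: sub_sigma_algebra; exists E => //; exists set0; last by rewrite setU0.
exact: negligible_set0.
Qed.

Lemma lebesgue_measurable_translate (c : R) (E : set R) :
  measurable (E : set LT) -> measurable ([set t | E (c + t)] : set LT).
Proof.
rewrite -[measurable _]/((completed_algebra_gen leb).-sigma.-measurable E).
rewrite -[X in _ -> X]/((completed_algebra_gen leb).-sigma.-measurable [set t | E (c + t)]).
rewrite g_sigma_completed_algebra_genE => -[B mB [N nN <-]].
exists [set t | B (c + t)]; first exact: measurable_translate.
exists [set t | N (c + t)]; first exact: negligible_translate.
by apply/seteqP; split => t.
Qed.

Lemma signal_piecewise A w (F : nat -> set R) (a : nat -> R -> 'rV[R]_k) :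
  (forall i, measurable (F i : set LT)) -> (forall i, signals A (a i)) ->
  (forall t, 0 <= t -> exists i, F i t) ->
  (forall i t, 0 <= t -> F i t -> w t = a i t) -> signals A w.
Proof.
move=> mF sa cov wa; split.
  by move=> t t0; have [i Fi] := cov t t0; rewrite (wa i)//; have [+ _] := sa i; exact.
move=> mD Y mY.
have -> : `[0, +oo[ `&` w @^-1` Y = \bigcup_i (F i `&` (`[0, +oo[ `&` a i @^-1` Y)).
  apply/seteqP; split => t.
    move=> [/=]; rewrite in_itv/= andbT => t0 wY.
    have [i Fi] := cov t t0; exists i => //; split => //; split => /=.
      by rewrite in_itv/= t0.
    by rewrite -(wa i).
  move=> [i _ [Fi [/= ]]]; rewrite in_itv/= andbT => t0 aY.
  by split => /=; rewrite ?in_itv/= ?t0// (wa i).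
apply: bigcupT_measurable => i; apply: measurableI => //.
by have [_ /(_ mD Y mY)] := sa i.
Qed.

Lemma signal_cst A p : A p -> signals A (fun=> p).
Proof. by move=> Ap; split => // mD; exact: measurable_cst. Qed.

Definition tail (c : R) a t := a (c + t).
Definition splice (c : R) a b t := if t < c then a t else b (t - c).

Lemma signal_tail A c a : 0 <= c -> signals A a -> signals A (tail c a).
Proof.
move=> c0 [Aa ma]; split => [t t0|mD Y mY]; first by apply: Aa; rewrite addr_ge0.
have := lebesgue_measurable_translate c (ma mD Y mY).
have m0 : measurable (`[0, +oo[%classic : set LT) by exact: mD.
move=> /(measurableI _ _ m0); congr measurable.
apply/seteqP; split => t [/=].
  by move=> + [].
rewrite !in_itv/= !andbT => t0 ?; split => //; split => //=.
exact: addr_ge0.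
Qed.

Lemma signal_splice A c a b : 0 <= c -> signals A a -> signals A b ->
  signals A (splice c a b).
Proof.
move=> c0 sa [Ab mb].
split.
  move=> t t0; rewrite /splice; case: ltP => [_|ct]; first by have [+ _] := sa; exact.
  by apply: Ab; rewrite subr_ge0.
move=> mD Y mY; have [_ ma] := sa.
have -> : `[0, +oo[ `&` splice c a b @^-1` Y =
   (`]-oo, c[%classic `&` (`[0, +oo[ `&` a @^-1` Y)) `|`
   [set t | (`[0, +oo[ `&` b @^-1` Y) (- c + t)].
  apply/seteqP; split => t /=; rewrite /splice !in_itv/= !andbT.
    by case: ltP => ct [t0 Yt]; [left|right; rewrite addrC subr_ge0].
  rewrite addrC subr_ge0 => -[[tc [t0 Yt]]|[ct Yt]]; first by rewrite tc.
  by rewrite ltNge ct; split => //; exact: le_trans ct.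
apply: measurableU.
  apply: measurableI; last exact: ma.
  by apply: lebesgue_measurable_borel.
exact: lebesgue_measurable_translate (mb mD Y mY).
Qed.

Lemma tail_splice c a b t : 0 <= t -> tail c (splice c a b) t = b t.
Proof. by move=> t0; rewrite /tail /splice ltNge lerDl t0 /= addrC addKr. Qed.

End Signals.

Section Selection.
Context {R : realType} {k j : nat}.

(** Finitely many open sets, on each of which one value b suits all points, cover
    A; sg takes the value of the first of them that contains its argument. *)
Lemma finite_borel_selection (A : set 'rV[R]_k) (B : set 'rV[R]_j)
   (G : 'rV[R]_k -> 'rV[R]_j -> Prop) : compact A -> B !=set0 ->
  (forall a, A a -> exists2 b, B b & \forall a' \near a, A a' -> G a' b) ->
  exists sg : 'rV[R]_k -> 'rV[R]_j,
    (forall a, A a -> G a (sg a)) /\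
    (forall w, signals A w -> signals B (fun t => sg (w t))).
Proof.
move=> cA [b0 Bb0] H.
have /choice[b_ Hb] : forall a, exists b,
    A a -> B b /\ (\forall a' \near a, A a' -> G a' b).
  move=> a; have [Aa|nAa] := pselect (A a); last by exists b0.
  by have [b Bb Gb] := H a Aa; exists b.
pose N : 'rV[R]_k -> set 'rV[R]_k := fun a => [set a' | A a' -> G a' (b_ a)]^°.
have [s sA As] : exists2 s : seq 'rV[R]_k, (forall c, c \in s -> A c) &
    (forall a, A a -> exists2 c, c \in s & N c a).
  have : cover_compact A by rewrite -compact_cover.
  move=> /(_ _ A N)[||s sA As].
  - by move=> a _; exact: open_interior.
  - by move=> a Aa; exists a => //; have [_] := Hb a Aa.
  exists (finmap.enum_fset s) => [c cs|a Aa]; first by have := sA c cs; rewrite inE.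
  by have [c cs Nc] := As a Aa; exists c.
(* b0 is a junk value, taken outside the union of the covering sets *)
pose sg (l : seq 'rV[R]_k) := foldr (fun a g x => if x \in N a then b_ a else g x) (fun=> b0) l.
exists (sg s); split.
  move=> a Aa; have [c cs Nc] := As a Aa.
  have : has (fun c => a \in N c) s by apply/hasP; exists c => //; rewrite inE.
  elim: s {sA As cs} => //= c' l IH; case: ifPn => [|_] /=; last exact: IH.
  by rewrite inE => /interior_subset/(_ Aa).
move=> w sw.
elim: s sA {As} => [_|c l IH lA] /=; first exact: signal_cst.
have sl : signals B (fun t => sg l (w t)).
  by apply: IH => c' c'l; apply: lA; rewrite inE c'l orbT.
have [_ mw] := sw.
apply: (@signal_piecewise _ _ _ _
  (fun i => `[0, +oo[ `&` if i is 0%N then w @^-1` N c else w @^-1` (~` N c))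
  (fun i => if i is 0%N then fun=> b_ c else fun t => sg l (w t))).
- have mD : measurable (`[0, +oo[%classic : set (g_sigma_algebraType
      (completed_algebra_gen (@lebesgue_measure R)))).
    by apply: lebesgue_measurable_borel.
  have mN : measurable (N c : set (g_sigma_algebraType (@open 'rV[R]_k))).
    by apply: sub_sigma_algebra; exact: open_interior.
  by case=> [|_]; apply: mw => //; exact: measurableC.
- case=> [|?]; last exact: sl.
  by apply: signal_cst; have [] := Hb c (lA c (mem_head _ _)).
- move=> t t0; have [?|?] := pselect (N c (w t)); [exists 0%N|exists 1%N];
    by split => //=; rewrite in_itv/= t0.
- by case=> [|i] t _ [_ /= Nt]; [rewrite mem_set|rewrite memNset].
Qed.

End Selection.

(** * Gronwall estimates *)

Section Gronwall.
Context {R : realType}.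
Notation leb := (@lebesgue_measure R).

(** Over a time interval on which increments are less than 1, a bound deteriorates
    by at most 1. *)
Lemma ac_bounded (W : normedModType R) (y : R -> W) (a b : R) : a <= b ->
  abs_continuous_on a b y ->
  exists B : R, forall t, a <= t <= b -> `|y t| <= B.
Proof.
move=> ab acy; have [r r0 Hr] := ac_unif_continuous acy (ltr01).
pose S t := exists B : R, forall s, a <= s <= t -> `|y s| <= B.
suff : S b by [].
apply: (@real_induction _ a b S) => //.
  by exists `|y a| => s /le_anti <-.
move=> t _; exists r => // s1 s2 as1 /andP[s1t ts2] s2b s12 [B HB].
exists (B + 1) => s /andP[as_ ss2].
have [ss1|s1s] := leP s s1.
  by apply: (@le_trans _ _ B); [apply: HB; rewrite as_|rewrite lerDl].
have h1 : `|y s1| <= B by apply: HB; rewrite as1 lexx.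
have h2 : `|y s - y s1| < 1 by apply: Hr => //; [exact: ltW|exact: le_trans s2b|lra].
by have := ler_normD (y s1) (y s - y s1); rewrite addrC subrK; lra.
Qed.

Lemma is_derive_translate (W : normedModType R) (y : R -> W) (c t : R) dy :
  is_derive (c + t) 1 y dy -> is_derive t 1 (fun t => y (c + t)) dy.
Proof.
have e : (fun h : R => h^-1 *: (((fun t => y (c + t)) \o shift t) (h *: (1 : R)) - y (c + t))) =
  (fun h : R => h^-1 *: ((y \o shift (c + t)) (h *: (1 : R)) - y (c + t))).
  by apply/funext => h; rewrite /= /shift addrCA.
move=> [d1 d2]; apply: DeriveDef; first by rewrite /derivable e.
by rewrite /derive e.
Qed.

Section step.
Context (W : normedModType R) (z : R -> W) (L : R).
Hypothesis L0 : 0 <= L.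

(** The differential inequality satisfied by the difference of two solutions. *)
Definition linear_growth a b := abs_continuous_on a b z /\
  {ae leb, forall t, a < t < b -> exists2 dz, is_derive t 1 z dz & `|dz| <= L * `|z t|}.

Lemma linear_growth_sub a b a' b' : a <= a' -> b' <= b ->
  linear_growth a b -> linear_growth a' b'.
Proof.
move=> aa bb [acz aez]; split; first exact: ac_sub acz.
apply: ae_imply aez => t + /andP[at_ tb]; apply; apply/andP; split.
  exact: le_lt_trans at_.
exact: lt_le_trans bb.
Qed.

(** Over a time with L (b - a) <= 1/2 the supremum of the norm of z is at most the
    norm of z a plus half of itself, hence at most twice the norm of z a.  The
    factor 2 L (b - a) in the conclusion tends to 0 with b - a, which makes short
    time displacements contracting. *)
Lemma gronwall_step a b : a <= b -> linear_growth a b -> L * (b - a) <= 2^-1 ->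
  `|z b - z a| <= 2 * L * (b - a) * `|z a|.
Proof.
move=> ab zab Lab.
have [B HB] := ac_bounded ab zab.1.
pose E := [set `|z t| | t in [set t | a <= t <= b]].
have supE : has_sup E.
  split; first by exists `|z a|, a => //=; rewrite lexx.
  by exists B => _ [t /= tab <-]; exact: HB.
have ubE t : a <= t <= b -> `|z t| <= sup E.
  by move=> tab; apply: ub_le_sup; [case: supE|exists t].
have incr t : a <= t <= b -> `|z t - z a| <= L * sup E * (t - a).
  move=> /andP[at_ tb]; have [acz aez] := linear_growth_sub (lexx a) tb zab.
  apply: ac_increment_le => //; apply: ae_imply aez => s Hs sat.
  have [dz Dz dzL] := Hs sat; exists dz => //; apply: le_trans dzL _.
  by apply: ler_wpM2l => //; apply: ubE; lra.
have E0 : 0 <= sup E by apply: le_trans (ubE a _) => //; rewrite lexx.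
have supEle : sup E <= 2 * `|z a|.
  suff : sup E <= `|z a| + 2^-1 * sup E by lra.
  apply: ge_sup; first by case: supE.
  move=> _ [t /= tab <-].
  have h1 := incr t tab.
  have h2 := ler_normD (z a) (z t - z a); rewrite addrC subrK in h2.
  have : L * sup E * (t - a) <= 2^-1 * sup E.
    rewrite mulrAC; apply: ler_wpM2r => //; apply: le_trans Lab.
    by apply: ler_wpM2l => //; lra.
  lra.
apply: le_trans (incr b _) _; first by rewrite ab lexx.
have : L * (b - a) * sup E <= L * (b - a) * (2 * `|z a|).
  by rewrite ler_wpM2l// mulr_ge0// subr_ge0.
lra.
Qed.

(** Iterating the short time estimate N times costs a factor 2 each time; this
    crude constant is enough, as it depends only on L and on the length of time. *)
Lemma gronwall N a b : a <= b -> linear_growth a b -> L * (b - a) <= N%:R / 2 ->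
  `|z b| <= 2 ^+ N * `|z a|.
Proof.
elim: N b => [|N IH] b ab zab Lab.
  have h : L * (b - a) <= 2^-1 by move: Lab; rewrite mul0r; lra.
  have := gronwall_step ab zab h.
  have -> : 2 * L * (b - a) * `|z a| = 0.
    have : L * (b - a) = 0.
      by apply/eqP; rewrite eq_le; move: Lab; rewrite mul0r => ->/=; rewrite mulr_ge0// subr_ge0.
    by rewrite -[2 * L * _]mulrA => ->; rewrite mulr0 mul0r.
  by rewrite normr_le0 subr_eq0 => /eqP ->; rewrite expr0 mul1r.
have [h|h] := leP (L * (b - a)) (N%:R / 2).
  apply: le_trans (IH b ab zab h) _; rewrite ler_wpM2r//.
  by rewrite exprS ler_peMl ?exprn_ge0// ler1n.
have Lp : 0 < L.
  rewrite lt_neqAle L0 andbT; apply/eqP => L00; move: h; rewrite -L00 mul0r.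
  by rewrite ltNge divr_ge0.
pose c := a + N%:R / 2 / L.
have ac : a <= c by rewrite lerDl divr_ge0// divr_ge0.
have Lca : L * (c - a) = N%:R / 2 by rewrite /c addrAC subrr add0r mulrC divfK// gt_eqF.
have cb : c <= b.
  have : L * (c - a) <= L * (b - a) by rewrite Lca ltW.
  by rewrite ler_pM2l// lerD2r.
have := IH c ac (linear_growth_sub (lexx a) cb zab); rewrite Lca => /(_ (lexx _)) h1.
have Lbc : L * (b - c) <= 2^-1.
  have -> : L * (b - c) = L * (b - a) - L * (c - a) by ring.
  rewrite Lca; move: Lab; rewrite -natr1; lra.
have h2 := gronwall_step cb (linear_growth_sub ac (lexx b) zab) Lbc.
have h3 := ler_normD (z c) (z b - z c); rewrite addrC subrK in h3.
have h4 : 2 * L * (b - c) * `|z c| <= `|z c|.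
  by rewrite -[2 * L * _]mulrA ler_piMl//; lra.
rewrite exprS; have := normr_ge0 (z c); lra.
Qed.

End step.
End Gronwall.

(** * The controlled flow *)

Section Flow.
Context {R : realType} {n m l : nat}.
Notation leb := (@lebesgue_measure R).
Context (U : set 'rV[R]_m) (D : set 'rV[R]_l)
  (f : 'rV[R]_n -> 'rV[R]_m -> 'rV[R]_l -> 'rV[R]_n)
  (phi : 'rV[R]_n -> (R -> 'rV[R]_m) -> (R -> 'rV[R]_l) -> R -> 'rV[R]_n).

Definition control : Type := (R -> 'rV[R]_m) * (R -> 'rV[R]_l).
Definition admissible : set control := [set w | signals U w.1 /\ signals D w.2].
Definition flow x (w : control) t := phi x w.1 w.2 t.
Definition velocity (w : control) t y := f y (w.1 t) (w.2 t).
Definition ctail (c : R) (w : control) : control := (tail c w.1, tail c w.2).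
Definition csplice (c : R) (w w' : control) : control :=
  (splice c w.1 w'.1, splice c w.2 w'.2).

Definition speed_bounds (r M L : R) := [/\ 0 < M, 0 < L,
  forall x u d, `|x| <= r -> U u -> D d -> `|f x u d| <= M &
  forall x y u d, `|x| <= r -> `|y| <= r -> U u -> D d ->
    `|f x u d - f y u d| <= L * `|x - y|].

Definition trajectory a b (w : control) (y : R -> 'rV[R]_n) :=
  abs_continuous_on a b y /\
  {ae leb, forall t, a < t < b -> is_derive t 1 y (velocity w t (y t))}.

Lemma admissible_tail c w : 0 <= c -> admissible w -> admissible (ctail c w).
Proof. by move=> c0 [? ?]; split; exact: signal_tail. Qed.

Lemma admissible_splice c w w' : 0 <= c -> admissible w -> admissible w' ->
  admissible (csplice c w w').
Proof. by move=> c0 [? ?] [? ?]; split; exact: signal_splice. Qed.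

Lemma trajectory_sub a b a' b' w y : a <= a' -> b' <= b ->
  trajectory a b w y -> trajectory a' b' w y.
Proof.
move=> aa bb [acy aey]; split; first exact: ac_sub acy.
apply: ae_imply aey => t + /andP[at_ tb]; apply; apply/andP; split.
  exact: le_lt_trans at_.
exact: lt_le_trans bb.
Qed.

Lemma trajectory_tail c a b w y : trajectory (c + a) (c + b) w y ->
  trajectory a b (ctail c w) (fun t => y (c + t)).
Proof.
move=> [acy aey]; split; first exact: ac_translate.
apply: ae_imply (ae_translate c aey) => t H tab.
by apply: is_derive_translate; apply: H; lra.
Qed.

Lemma trajectory_increment a b w y r M L : a <= b -> 0 <= a -> admissible w ->
  trajectory a b w y -> speed_bounds r M L ->
  (forall t, a <= t <= b -> `|y t| <= r) -> `|y b - y a| <= M * (b - a).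
Proof.
move=> ab a0 [Uw Dw] [acy aey] [M0 L0 fM fL] yr.
apply: ac_increment_le => //; apply: ae_imply aey => t + tab => /(_ tab) dy.
exists (velocity w t (y t)) => //.
have t0 : 0 <= t by lra.
apply: fM; [by apply: yr; lra|by have [+ _] := Uw; exact|by have [+ _] := Dw; exact].
Qed.

Lemma trajectory_diff a b w w' y y' r M L : a <= b -> 0 <= a ->
  admissible w -> {ae leb, forall t, a < t < b -> w'.1 t = w.1 t /\ w'.2 t = w.2 t} ->
  trajectory a b w y -> trajectory a b w' y' -> speed_bounds r M L ->
  (forall t, a <= t <= b -> `|y t| <= r) ->
  (forall t, a <= t <= b -> `|y' t| <= r) ->
  linear_growth (fun t => y t - y' t) L a b.
Proof.
move=> ab a0 [Uw Dw] ww [acy aey] [acy' aey'] [M0 L0 fM fL] yr yr'.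
split.
  apply: (@ac_dominated _ _ _ _ y y' _ a b 1) => // s t as_ st tb.
  rewrite mul1r; have -> : y t - y' t - (y s - y' s) = (y t - y s) - (y' t - y' s).
    by rewrite !opprB addrACA [RHS]addrACA [X in _ = _ + X]addrC.
  apply: le_trans (ler_normB _ _) _; lra.
apply: ae_imply2 (ae_imply2 (fun t a b => conj a b) aey aey') ww => t [dy dy'] ww tab.
have [e1 e2] := ww tab.
have {}dy := dy tab; have {}dy' := dy' tab.
exists (velocity w t (y t) - velocity w' t (y' t)); first exact: is_deriveB.
have t0 : 0 <= t by lra.
rewrite /velocity e1 e2; apply: fL; [by apply: yr; lra|by apply: yr'; lra| |].
  by have [+ _] := Uw; exact.
by have [+ _] := Dw; exact.
Qed.

Hypothesis bounds : forall r, exists M L, speed_bounds r M L.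

(** The flow is assumed unique among solutions on the whole half-line; this is
    uniqueness up to time T, for controls that need to agree only up to time T.
    The semigroup and causality properties of the flow below come from it. *)
Lemma trajectory_unique T w w' y y' : 0 <= T -> admissible w ->
  {ae leb, forall t, 0 < t < T -> w'.1 t = w.1 t /\ w'.2 t = w.2 t} ->
  trajectory 0 T w y -> trajectory 0 T w' y' -> y 0 = y' 0 -> y T = y' T.
Proof.
move=> T0 aw ww ty ty' y0.
have [B HB] := ac_bounded T0 ty.1; have [B' HB'] := ac_bounded T0 ty'.1.
have [M [L ML]] := bounds (Num.max B B').
have L0 : 0 <= L by have [_ /ltW] := ML.
have zb : linear_growth (fun t => y t - y' t) L 0 T.
  apply: (trajectory_diff T0 (lexx 0) aw ww ty ty' ML) => t tT; rewrite le_max.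
    by rewrite HB.
  by rewrite HB' ?orbT.
pose N := (Num.truncn (2 * (L * (T - 0)))).+1.
have := gronwall L0 (N := N) T0 zb.
rewrite y0 subrr normr0 mulr0 normr_le0 subr_eq0 => H; apply/eqP/H.
rewrite ler_pdivlMr// mulrC ltW//; exact: truncnS_gt.
Qed.

Section flow.
Hypothesis phi_flow : solution_flow U D f phi.

Lemma flow0 w x : admissible w -> flow x w 0 = x.
Proof. by move=> [Uw Dw]; have [[]] := phi_flow x Uw Dw. Qed.

Lemma flow_trajectory w x a b : 0 <= a -> admissible w ->
  trajectory a b w (flow x w).
Proof.
move=> a0 [Uw Dw]; have [[_ acy aey] _] := phi_flow x Uw Dw.
have [b0|b0] := leP 0 b; last first.
  split.
    move=> e e0; exists 1 => // k s t st _ _; rewrite big1// => i.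
    by have := st i; lra.
  by apply: (@ae_imply _ (fun=> True)) => [t _|]; [lra|exact: aeW].
apply: (@trajectory_sub 0 b) => //; split; first exact: acy.
by apply: ae_imply aey => t + /andP[t0 _]; exact.
Qed.

Lemma flow_unique w w' x T y : 0 <= T -> admissible w -> 
  {ae leb, forall t, 0 < t < T -> w'.1 t = w.1 t /\ w'.2 t = w.2 t} ->
  trajectory 0 T w' y -> y 0 = x -> y T = flow x w T.
Proof.
move=> T0 aw ww ty y0; apply/esym.
by apply: (trajectory_unique T0 aw ww _ ty); [exact: flow_trajectory|rewrite flow0].
Qed.

Lemma flow_eq w w' x T : 0 <= T -> admissible w -> admissible w' ->
  {ae leb, forall t, 0 < t < T -> w'.1 t = w.1 t /\ w'.2 t = w.2 t} ->
  flow x w' T = flow x w T.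
Proof.
move=> T0 aw aw' ww; apply: (flow_unique T0 aw ww); last exact: flow0.
exact: flow_trajectory.
Qed.

Lemma flow_tail w x c t : 0 <= c -> 0 <= t -> admissible w ->
  flow (flow x w c) (ctail c w) t = flow x w (c + t).
Proof.
move=> c0 t0 aw; apply/esym.
apply: (@flow_unique (ctail c w) (ctail c w) _ _ (fun t => flow x w (c + t))) => //.
- exact: admissible_tail.
- exact: aeW.
- by apply: trajectory_tail; apply: flow_trajectory => //; rewrite addr0.
- by rewrite addr0.
Qed.

Lemma flow_splice_before w w' x c t : 0 <= t <= c -> admissible w -> admissible w' ->
  flow x (csplice c w w') t = flow x w t.
Proof.
move=> /andP[t0 tc] aw aw'; have c0 := le_trans t0 tc.
apply: flow_eq => //; first exact: admissible_splice.
by apply: aeW => s /andP[_ st]; rewrite /= /splice (lt_le_trans st tc).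
Qed.

Lemma flow_splice_after w w' x c t : 0 <= t -> 0 <= c -> admissible w -> admissible w' ->
  flow x (csplice c w w') (c + t) = flow (flow x w c) w' t.
Proof.
move=> t0 c0 aw aw'; have aww := admissible_splice c0 aw aw'.
rewrite -flow_tail// flow_splice_before ?c0 ?lexx//.
apply: flow_eq => //; first exact: admissible_tail.
by apply: aeW => s /andP[/ltW s0 _]; rewrite /= !tail_splice.
Qed.

End flow.
End Flow.

Section Bounds.
Context {R : realType} {n m l : nat}.
Context (U : set 'rV[R]_m) (D : set 'rV[R]_l)
  (f : 'rV[R]_n -> 'rV[R]_m -> 'rV[R]_l -> 'rV[R]_n).

Lemma speed_bounds_exist r : compact U -> compact D ->
  {within [set z : 'rV[R]_n * ('rV[R]_m * 'rV[R]_l) | U z.2.1 /\ D z.2.2],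
     continuous (fun z => f z.1 z.2.1 z.2.2)} ->
  locally_lipschitz_uniformly U D f -> exists M L, speed_bounds U D f r M L.
Proof.
move=> cU cD cf lf.
have cK : compact [set x : 'rV[R]_n | `|x| <= r].
  have -> : [set x : 'rV[R]_n | `|x| <= r] = [set x : 'rV[R]_n | `|x - 0| <= r].
    by apply/seteqP; split => x /=; rewrite subr0.
  exact: compact_rV_ball.
have cA := compact_setX cK (compact_setX cU cD).
have /compact_bounded[M [_ HM]] : compact ((fun z => f z.1 z.2.1 z.2.2) @`
   ([set x : 'rV[R]_n | `|x| <= r] `*` (U `*` D))).
  apply: continuous_compact cA; apply: continuous_subspaceW cf.
  by move=> [x [u d]] /= [_ []].
have fM x u d : `|x| <= r -> U u -> D d -> `|f x u d| <= `|M| + 1.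
  move=> xr Uu Dd; apply: (HM (`|M| + 1)).
    by rewrite (le_lt_trans (ler_norm M))// ltrDl.
  by exists (x, (u, d)).
have [L L0 HL] := lipschitz_on_compact cK lf fM.
by exists (`|M| + 1), L; split => //; rewrite ltr_wpDl.
Qed.

End Bounds.

(** * The flow over short times *)

Section Reach.
Context {R : realType} {n m l : nat}.
Context (U : set 'rV[R]_m) (D : set 'rV[R]_l)
  (f : 'rV[R]_n -> 'rV[R]_m -> 'rV[R]_l -> 'rV[R]_n)
  (phi : 'rV[R]_n -> (R -> 'rV[R]_m) -> (R -> 'rV[R]_l) -> R -> 'rV[R]_n).
Hypothesis bounds : forall r, exists M L, speed_bounds U D f r M L.
Hypothesis phi_flow : solution_flow U D f phi.
Notation flow := (flow phi).
Notation admissible := (admissible U D).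

(** Trajectories that start in the ball of radius r + 2 move by at most 1 within
    time dt, and their displacement is a 1/2-Lipschitz function of the initial
    state. *)
Definition short_time (r dt : R) := 0 < dt /\
  exists M L, [/\ speed_bounds U D f (r + 3) M L, dt * M <= 2^-1 & dt * L <= 4^-1].

Lemma short_time_exists r : exists dt, short_time r dt.
Proof.
have [M [L ML]] := bounds (r + 3); have [M0 L0 _ _] := ML.
exists (4 * (M + L))^-1; have ML0 : 0 < 4 * (M + L) by lra.
split; first by rewrite invr_gt0.
exists M, L; split => //; rewrite mulrC ler_pdivrMr//; lra.
Qed.

Lemma short_time_le r dt r' dt' : r' <= r -> 0 < dt' <= dt ->
  short_time r dt -> short_time r' dt'.
Proof.
move=> rr /andP[dt0 dd] [_ [M [L [[M0 L0 fM fL] dM dL]]]]; split => //.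
exists M, L; split; [split => //| |].
- by move=> x u d xr; apply: fM; lra.
- by move=> x y u d xr yr; apply: fL; lra.
- by apply: le_trans dM; rewrite ler_wpM2r// ltW.
- by apply: le_trans dL; rewrite ler_wpM2r// ltW.
Qed.

(** As long as a trajectory stays within distance 1 of x its speed is at most M,
    so that it has moved by at most dt M <= 1/2; hence it never comes close to the
    boundary of that ball. *)
Lemma flow_stay r dt x w t : short_time r dt -> `|x| <= r + 2 -> admissible w ->
  0 <= t <= dt -> `|flow x w t - x| <= 1.
Proof.
move=> [dt0 [M [L [ML dM dL]]]] xr aw /andP[t0 tdt].
have ty : trajectory f 0 dt w (flow x w) by exact: (flow_trajectory phi_flow).
have f0 : flow x w 0 = x by exact: (flow0 phi_flow).
have [rho rho0 Hrho] := ac_unif_continuous ty.1 (e := 2^-1) (ltac:(by rewrite invr_gt0)).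
pose S t := forall s, 0 <= s <= t -> `|flow x w s - x| <= 2^-1.
suff /(_ t) H : S dt by apply: le_trans (H _) _; [rewrite t0|lra].
apply: (@real_induction _ 0 dt S); first exact: ltW.
  by move=> s /le_anti <-; rewrite f0 subrr normr0 invr_ge0.
move=> c _; exists rho => // s1 s2 s10 /andP[s1c cs2] s2dt s12 S1.
have near1 s : 0 <= s <= s2 -> `|flow x w s - x| <= 1.
  move=> /andP[s0 ss2]; have [ss1|s1s] := leP s s1.
    by apply: le_trans (S1 s _) _; [rewrite s0|lra].
  have h1 : `|flow x w s - flow x w s1| < 2^-1.
    apply: Hrho => //; [exact: ltW|exact: le_trans s2dt|lra].
  have h2 : `|flow x w s1 - x| <= 2^-1 by apply: S1; rewrite s10 lexx.
  have := ler_normD (flow x w s - flow x w s1) (flow x w s1 - x).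
  rewrite addrA subrK; lra.
move=> s /andP[s0 ss2].
rewrite -{2}f0.
have h : `|flow x w s - flow x w 0| <= M * (s - 0).
  apply: (trajectory_increment s0 (lexx 0) aw _ ML).
    by apply: trajectory_sub ty => //; exact: le_trans s2dt.
  move=> q /andP[q0 qs]; have := near1 q; rewrite q0 (le_trans qs)// => /(_ isT).
  have := ler_normD (flow x w q - x) x; rewrite subrK; lra.
apply: (le_trans h); rewrite subr0; apply: le_trans dM; rewrite mulrC.
by have [M0 _ _ _] := ML; apply: ler_wpM2r; [exact: ltW|exact: le_trans s2dt].
Qed.

Lemma flow_stay_norm r dt x w t : short_time r dt -> `|x| <= r + 2 ->
  admissible w -> 0 <= t <= dt -> `|flow x w t| <= r + 3.
Proof.
move=> sh xr aw t0; have := flow_stay sh xr aw t0.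
have := ler_normD (flow x w t - x) x; rewrite subrK; lra.
Qed.

Lemma flow_displacement_lipschitz r dt x x' w t : short_time r dt ->
  `|x| <= r + 2 -> `|x'| <= r + 2 -> admissible w -> 0 <= t <= dt ->
  `|(flow x w t - flow x' w t) - (x - x')| <= 2^-1 * `|x - x'|.
Proof.
move=> sh xr xr' aw /andP[t0 tdt]; have [dt0 [M [L [ML dM dL]]]] := sh.
have L0 : 0 < L by have [] := ML.
have gb : linear_growth (fun s => flow x w s - flow x' w s) L 0 t.
  apply: (trajectory_diff t0 (lexx 0) aw _ _ _ ML).
  - exact: aeW.
  - exact: (flow_trajectory phi_flow).
  - exact: (flow_trajectory phi_flow).
  - by move=> s /andP[s0 st]; apply: (flow_stay_norm sh) => //; rewrite s0 (le_trans st).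
  - by move=> s /andP[s0 st]; apply: (flow_stay_norm sh) => //; rewrite s0 (le_trans st).
have tL : L * (t - 0) <= 4^-1.
  by rewrite subr0 mulrC; apply: le_trans dL; rewrite ler_wpM2r// ltW.
have tL2 : L * (t - 0) <= 2^-1 by lra.
have := gronwall_step (ltW L0) t0 gb tL2.
rewrite /= !(flow0 phi_flow)// => /le_trans; apply.
rewrite ler_wpM2r//; lra.
Qed.

(** The initial state x from which y is reached solves
    x = y - (flow x w t - x), whose right-hand side is a contraction in x. *)
Lemma flow_onto r dt a w t e y : short_time r dt -> `|a| <= r + 1 ->
  0 <= e <= 1 -> admissible w -> 0 <= t <= dt -> `|y - flow a w t| <= e / 2 ->
  exists2 x, `|x - a| <= e & flow x w t = y.
Proof.
move=> sh ar /andP[e0 e1] aw tdt yt.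
have near2 x : `|x - a| <= e -> `|x| <= r + 2.
  by have := ler_normD (x - a) a; rewrite subrK; lra.
pose F x := y - (flow x w t - x).
suff [x xa Fx] : exists2 x, `|x - a| <= e & F x = x.
  exists x => //; apply/rowP => i; move/rowP/(_ i): Fx; rewrite !mxE; lra.
apply: (contraction_fixed_point e0 (@compact_rV_ball R n a e)) => [x xa|x x' xa xa']; rewrite /F.
- have -> : y - (flow x w t - x) - a = (y - flow a w t) - ((flow x w t - flow a w t) - (x - a)).
    by apply/rowP => i; rewrite !mxE; ring.
  apply: le_trans (ler_normB _ _) _.
  have ar2 : `|a| <= r + 2 by lra.
  have := flow_displacement_lipschitz sh (near2 x xa) ar2 aw tdt; lra.
- have -> : y - (flow x w t - x) - (y - (flow x' w t - x')) =
     - ((flow x w t - flow x' w t) - (x - x')).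
    by apply/rowP => i; rewrite !mxE; ring.
  rewrite normrN; exact: (flow_displacement_lipschitz sh (near2 x xa) (near2 x' xa') aw tdt).
Qed.

(** Continuity and openness of g at a: images of neighbourhoods of a are
    neighbourhoods of g a. *)
Definition continuous_open_at (g : 'rV[R]_n -> 'rV[R]_n) a :=
  (forall e : R, 0 < e -> exists2 eta : R, 0 < eta &
     forall x, `|x - a| < eta -> `|g x - g a| < e) /\
  (forall e : R, 0 < e -> exists2 eta : R, 0 < eta &
     forall y, `|y - g a| < eta -> exists2 x, `|x - a| < e & g x = y).

Lemma continuous_open_at_comp g g' a : continuous_open_at g a -> continuous_open_at g' (g a) ->
  continuous_open_at (g' \o g) a.
Proof.
move=> [gc go] [gc' go']; split => e e0.
  have [e1 e10 H1] := gc' e e0; have [e2 e20 H2] := gc e1 e10.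
  by exists e2 => // x /H2/H1.
have [e1 e10 H1] := go e e0; have [e2 e20 H2] := go' e1 e10.
exists e2 => // y /H2[x /H1[x' x'a <-] <-]; by exists x'.
Qed.

Lemma flow_continuous_open_short r dt a w t : short_time r dt -> `|a| <= r + 1 ->
  admissible w -> 0 <= t <= dt -> continuous_open_at (fun x => flow x w t) a.
Proof.
move=> sh ar aw tdt; split => e e0.
  exists (Num.min 1 (e / 2)); first by rewrite lt_min ltr01 divr_gt0.
  move=> x; rewrite lt_min => /andP[x1 xe].
  have xr : `|x| <= r + 2 by have := ler_normD (x - a) a; rewrite subrK; lra.
  have ar2 : `|a| <= r + 2 by lra.
  have := flow_displacement_lipschitz sh xr ar2 aw tdt.
  have := ler_normD (flow x w t - flow a w t - (x - a)) (x - a).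
  rewrite subrK; lra.
pose e1 := Num.min 1 (e / 2).
have e10 : 0 < e1 by rewrite lt_min ltr01 divr_gt0.
have e1e : e1 < e by rewrite gt_min; apply/orP; right; lra.
exists (e1 / 2); first by rewrite divr_gt0.
move=> y ya; have [|x xa <-] := flow_onto (e := e1) sh ar _ aw tdt (ltW ya).
  by rewrite (ltW e10)/= ge_min lexx.
by exists x => //; exact: le_lt_trans e1e.
Qed.

(** Over a long time the flow is a composition of flows over times so short that
    the local estimates apply along the whole trajectory. *)
Lemma flow_continuous_open a w t : 0 <= t -> admissible w ->
  continuous_open_at (fun x => flow x w t) a.
Proof.
move=> t0 aw.
have [B HB] := ac_bounded t0 (flow_trajectory phi_flow a t (lexx 0) aw).1.
have [dt sh] := short_time_exists B; have [dt0 _] := sh.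
have [N] : exists N : nat, t <= N%:R * dt.
  exists (Num.truncn (t / dt)).+1; rewrite -ler_pdivrMr//; exact/ltW/truncnS_gt.
elim: N t a w t0 aw HB => [|N IH] t a w t0 aw HB tN.
  have aB : `|a| <= B by have := HB 0; rewrite lexx t0 (flow0 phi_flow)//; exact.
  by apply: (flow_continuous_open_short sh) => //; lra.
have aB : `|a| <= B + 1.
  by have := HB 0; rewrite lexx t0 (flow0 phi_flow)// => /(_ isT); lra.
have [tdt|dtt] := leP t dt.
  by apply: (flow_continuous_open_short sh) => //; rewrite t0.
have -> : (fun x => flow x w t) =
   (fun x => flow x (ctail dt w) (t - dt)) \o (fun x => flow x w dt).
  apply/funext => x /=; rewrite (flow_tail bounds phi_flow)//; [|lra..].
  by rewrite addrC subrK.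
apply: continuous_open_at_comp.
  by apply: (flow_continuous_open_short sh) => //; rewrite ltW/=.
apply: IH.
- lra.
- by apply: admissible_tail => //; exact: ltW.
- move=> s /andP[s0 st]; rewrite (flow_tail bounds phi_flow)//; last exact: ltW.
  by apply: HB; lra.
- by move: tN; rewrite -natr1; lra.
Qed.

End Reach.

(** * Boundedness of reachable sets *)

Lemma bounded_seq_cluster (R : realType) n (z : nat -> 'rV[R]_n) (B : R) :
  (forall i, `|z i| <= B) ->
  exists y, forall e N, 0 < e -> exists2 i, (N <= i)%N & `|z i - y| < e.
Proof.
move=> zB; have [|y [_ cy]] := @compact_rV_ball R n 0 B (z @ \oo) _.
  by exists 0%N => // i _ /=; rewrite subr0.
exists y => e N e0.
have Bz : (z @ \oo) (z @` [set i | (N <= i)%N]).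
  by exists N => // i /= Ni; exists i.
have [_ [[i /= Ni <-] yi]] := cy _ _ Bz (nbhsx_ballx y _ e0).
by exists i => //; move: yi; rewrite -ball_normE /= distrC.
Qed.

Lemma signal_limit (R : realType) k (A : set 'rV[R]_k) (a : nat -> R -> 'rV[R]_k)
    (tt : nat -> R) : (forall i, signals A (a i)) ->
  (forall i j t, t < tt i -> t < tt j -> a i t = a j t) ->
  exists2 w, signals A w & forall i t, t < tt i -> w t = a i t.
Proof.
move=> sa aa.
have /choice[w Hw] : forall t, exists v, (forall i, t < tt i -> v = a i t) /\
    ((forall i, ~ t < tt i) -> v = a 0%N t).
  move=> t; have [[i ti]|nt] := pselect (exists i, t < tt i).
    exists (a i t); split => [j tj|/(_ i)//]; exact: aa.
  exists (a 0%N t); split => // i ti; by case: nt; exists i.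
exists w; last by move=> i t; exact: (Hw t).1.
pose F i : set R := if i is i.+1 then `]-oo, tt i[%classic
   else ~` \bigcup_j `]-oo, tt j[%classic.
apply: (@signal_piecewise _ _ A w F (fun i => a i.-1)) => //.
- move=> i; apply: lebesgue_measurable_borel; case: i => [|i] //=.
  by apply: measurableC; apply: bigcupT_measurable => j.
- move=> t _; have [[i ti]|nt] := pselect (exists i, t < tt i).
    by exists i.+1; rewrite /F/= in_itv.
  exists 0%N => -[j _]; rewrite /= in_itv/= => tj; by apply: nt; exists j.
- case=> [|i] t _ /=.
    by move=> nt; apply: (Hw t).2 => j tj; apply: nt; exists j => //=; rewrite in_itv.
  by rewrite in_itv/=; exact: (Hw t).1.
Qed.

Section ReachBounded.
Context {R : realType} {n m l : nat}.
Context (U : set 'rV[R]_m) (D : set 'rV[R]_l)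
  (f : 'rV[R]_n -> 'rV[R]_m -> 'rV[R]_l -> 'rV[R]_n)
  (phi : 'rV[R]_n -> (R -> 'rV[R]_m) -> (R -> 'rV[R]_l) -> R -> 'rV[R]_n).
Hypothesis bounds : forall r, exists M L, speed_bounds U D f r M L.
Hypothesis phi_flow : solution_flow U D f phi.
Notation flow := (flow phi).
Notation admissible := (admissible U D).
Notation short_time := (short_time U D f).

(** Unboundedness is required near x and not only from x itself: this property is
    inherited by limits of reached states, although these need not be reached. *)
Definition blows_up_near (s : R) (x : 'rV[R]_n) := forall e B : R, 0 < e ->
  exists x' w t, [/\ `|x' - x| < e, admissible w, 0 <= t <= s & B < `|flow x' w t|].

(** Among the trajectories that reach norms tending to infinity, all are still in
    a fixed ball at time dt; a cluster point y of their positions at that time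
    again has trajectories nearby that become large, within time s - dt.  As y is
    close to reached states, and the flow over time dt is onto a ball of uniform
    size, y itself is reached from points close to x. *)
Lemma blows_up_step r dt s x : short_time r dt -> `|x| <= r -> blows_up_near s x ->
  dt < s /\ exists y, blows_up_near (s - dt) y /\
    forall e : R, 0 < e -> exists x' w,
      [/\ `|x' - x| < e, admissible w & flow x' w dt = y].
Proof.
move=> sh xr bx; have [dt0 _] := sh.
have /choice[g Hg] : forall k : nat, exists p : ('rV[R]_n * control (R:=R) (m:=m) (l:=l)) * R,
    [/\ `|p.1.1 - x| < k.+1%:R^-1, admissible p.1.2, 0 <= p.2 <= s &
       k%:R + r + 3 < `|flow p.1.1 p.1.2 p.2|].
  move=> k; have k0 : 0 < (k.+1%:R : R)^-1 by rewrite invr_gt0.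
  have [x' [w [t [? ? ? ?]]]] := bx _ (k%:R + r + 3) k0.
  by exists ((x', w), t).
have k1 k : (k.+1%:R : R)^-1 <= 1 by rewrite invf_le1// ler1n.
have gr k : `|(g k).1.1| <= r + 1.
  have [h _ _ _] := Hg k; have {}h := lt_le_trans h (k1 k).
  have := ler_normD ((g k).1.1 - x) x; rewrite subrK; lra.
have gr2 k : `|(g k).1.1| <= r + 2 by have := gr k; lra.
have late k : dt < (g k).2.
  have [_ aw /andP[t0 ts] big] := Hg k; rewrite ltNge; apply/negP => tdt.
  have := flow_stay_norm phi_flow sh (gr2 k) aw (introT andP (conj t0 tdt)).
  have : 0 <= k%:R :> R by []. lra.
have dts : dt < s by have [_ _ /andP[_ ts] _] := Hg 0%N; exact: lt_le_trans ts.
split => //.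
pose z k := flow (g k).1.1 (g k).1.2 dt.
have zB k : `|z k| <= r + 3.
  have [_ aw _ _] := Hg k.
  by apply: (flow_stay_norm phi_flow sh (gr2 k) aw); rewrite ltW/=.
have [y cy] := bounded_seq_cluster zB.
exists y; split.
  move=> e B e0.
  have [k Bk zy] := cy e (Num.truncn B).+1 e0.
  have [_ aw /andP[t0 ts] big] := Hg k; have := late k => dtt.
  exists (z k), (ctail dt (g k).1.2), ((g k).2 - dt); split => //.
  - by apply: admissible_tail => //; exact: ltW.
  - by rewrite subr_ge0 ltW//= lerD2r.
  - rewrite /z (flow_tail bounds phi_flow)//; [|exact: ltW|by rewrite subr_ge0 ltW].
    rewrite addrC subrK; apply: lt_trans big.
    have : B < (Num.truncn B).+1%:R by exact: truncnS_gt.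
    have : (Num.truncn B).+1%:R <= k%:R :> R by rewrite ler_nat.
    have := le_trans (normr_ge0 _) xr; lra.
move=> e e0.
pose e' := Num.min 1 (e / 4).
have e'0 : 0 < e' by rewrite lt_min ltr01 divr_gt0.
have e'4 : e' <= e / 4 by rewrite ge_min lexx orbT.
have e'2 : 0 < e' / 2 by rewrite divr_gt0.
have [k Nk zy] := cy (e' / 2) (Num.truncn (4 / e)).+1 e'2.
have [xk aw _ _] := Hg k.
have e'01 : 0 <= e' <= 1 by rewrite ltW//= ge_min lexx.
have dtdt : 0 <= dt <= dt by rewrite ltW/=.
have yz : `|y - flow (g k).1.1 (g k).1.2 dt| <= e' / 2 by rewrite distrC; exact: ltW.
have [x' x'x fx'] := flow_onto phi_flow sh (gr k) e'01 aw dtdt yz.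
exists x', (g k).1.2; split => //.
have : (k.+1%:R : R)^-1 <= e / 4.
  have h : 4 / e < k.+1%:R.
    apply: (lt_trans (truncnS_gt _)); rewrite ltr_nat ltnS; exact: Nk.
  by rewrite -[e / 4]invf_div lef_pV2 ?posrE ?divr_gt0// ltW.
move=> /(lt_le_trans xk) {}xk.
have := ler_normD (x' - (g k).1.1) ((g k).1.1 - x); rewrite addrA subrK; lra.
Qed.

(** A nonincreasing choice of the short times, so that steps taken from a bounded
    set have durations bounded below. *)
Lemma uniform_short_times : exists2 dt : nat -> R, (forall N, short_time N%:R (dt N)) &
  (forall i j, (i <= j)%N -> dt j <= dt i).
Proof.
have /choice[d Hd] : forall N : nat, exists dt, short_time N%:R dt.
  by move=> N; exact: short_time_exists.
pose dt := nat_rect (fun=> R) (d 0%N) (fun N x => Num.min (d N.+1) x).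
have dt0 N : 0 < dt N.
  by elim: N => [|N IH] /=; rewrite ?lt_min ?IH ?andbT; [have [] := Hd 0%N|have [] := Hd N.+1].
have dtd N : dt N <= d N by case: N => [|N] //=; rewrite ge_min lexx.
exists dt.
  by move=> N; apply: (short_time_le (lexx _) _ (Hd N)); rewrite dt0 dtd.
move=> i j; apply: (@homo_leq _ dt (fun a b => b <= a)) => [x|y x z yx zy|k] /=.
- exact: lexx.
- exact: le_trans yx.
- by rewrite ge_min lexx orbT.
Qed.

(** Each step uses up some of the remaining time, and steps from a bounded set
    have durations bounded below; as the remaining time stays positive, the points
    y k cannot stay bounded. *)
Lemma blow_up_chain s x : blows_up_near s x ->
  exists (y : nat -> 'rV[R]_n) (t : nat -> R), [/\ y 0%N = x, t 0%N = 0,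
    (forall k, t k <= t k.+1 /\ t k.+1 <= s),
    (forall k (e : R), 0 < e -> exists x' w,
      [/\ `|x' - y k| < e, admissible w & flow x' w (t k.+1 - t k) = y k.+1]) &
    forall B : R, exists k, B < `|y k|].
Proof.
move=> bx; have [dt sdt dtle] := uniform_short_times.
pose rad (x : 'rV[R]_n) := (Num.truncn `|x|).+1.
have radP v : `|v| <= (rad v)%:R by apply/ltW/truncnS_gt.
have /choice[nx Hnx] : forall p : 'rV[R]_n * R, exists y, blows_up_near p.2 p.1 ->
   [/\ dt (rad p.1) < p.2, blows_up_near (p.2 - dt (rad p.1)) y &
     forall e : R, 0 < e -> exists x' w,
      [/\ `|x' - p.1| < e, admissible w & flow x' w (dt (rad p.1)) = y]].
  move=> [v q]; have [bv|nb] := pselect (blows_up_near q v); last by exists 0.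
  by have [? [y [? ?]]] := blows_up_step (sdt (rad v)) (radP v) bv; exists y.
pose st k := iter k (fun p => (nx p, p.2 - dt (rad p.1))) (x, s).
have bst k : blows_up_near (st k).2 (st k).1.
  by elim: k => //= k IH; have [] := Hnx _ IH.
have dt0 k : 0 < dt k by have [] := sdt k.
exists (fun k => (st k).1), (fun k => s - (st k).2); split => //=.
- by rewrite subrr.
- by move=> k; have := dt0 (rad (st k).1); have [] := Hnx _ (bst k); rewrite /=; lra.
- move=> k e e0; have [_ _ /(_ e e0)[x' [w [? ? ?]]]] := Hnx _ (bst k).
  exists x', w; split => //.
  by have -> : s - ((st k).2 - dt (rad (st k).1)) - (s - (st k).2) = dt (rad (st k).1) by ring.
- move=> B; apply: contrapT => nB.
  have yB k : `|(st k).1| <= B by rewrite leNgt; apply/negP => h; apply: nB; exists k.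
  pose c := dt (Num.truncn B).+1.
  have sc k : (st k).2 <= s - k%:R * c.
    elim: k => [|k IH] /=; first by rewrite mul0r subr0.
    have : c <= dt (rad (st k).1) by apply: dtle; rewrite ltnS; exact: le_truncn.
    by rewrite -natr1; lra.
  have := sc (Num.truncn (s / c)).+1; have [h _ _] := Hnx _ (bst (Num.truncn (s / c)).+1).
  have := dt0 (rad (st (Num.truncn (s / c)).+1).1).
  have : s / c * c < (Num.truncn (s / c)).+1%:R * c.
    by rewrite ltr_pM2r; [exact: truncnS_gt|exact: dt0].
  rewrite (divfK (lt0r_neq0 (dt0 _))); lra.
Qed.

(** The state q k consists of a closed ball of initial states and of a control
    such that the center reaches y k at time t k and the whole ball arrives within
    distance 1.  By openness some state of the ball reaches a point from which
    y (k+1) can be reached; a small ball around it is the next one.  The balls are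
    nested and each control extends the previous one, so a common point of the
    balls and the union of the controls have the required property. *)
Lemma chain_shadowing (y : nat -> 'rV[R]_n) (t : nat -> R) w0 : admissible w0 ->
  t 0%N = 0 -> (forall k, t k <= t k.+1) ->
  (forall k (e : R), 0 < e -> exists x' w,
      [/\ `|x' - y k| < e, admissible w & flow x' w (t k.+1 - t k) = y k.+1]) ->
  exists a w, admissible w /\ forall k, `|flow a w (t k) - y k| <= 1.
Proof.
move=> aw0 t00 tS chain.
have t_mono i j : (i <= j)%N -> t i <= t j.
  exact: (@homo_leq _ t (fun a b => a <= b) (@lexx _ _) (@le_trans _ _) tS).
have t0 k : 0 <= t k by rewrite -t00; exact: t_mono.
pose state : Type := ('rV[R]_n * R) * control (R:=R) (m:=m) (l:=l).
pose inv k (q : state) := [/\ 0 < q.1.2, admissible q.2, flow q.1.1 q.2 (t k) = y k &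
  forall x, `|x - q.1.1| <= q.1.2 -> `|flow x q.2 (t k) - y k| <= 1].
have /choice[nx Hnx] : forall kq : nat * state, exists q' : state, inv kq.1 kq.2 ->
  [/\ inv kq.1.+1 q',
   forall x, `|x - q'.1.1| <= q'.1.2 -> `|x - kq.2.1.1| <= kq.2.1.2 &
   forall s, s < t kq.1 -> q'.2.1 s = kq.2.2.1 s /\ q'.2.2 s = kq.2.2.2 s].
  move=> [k [[a rho] w]]; set q := ((a, rho), w) : state.
  have [iq|nq] := pselect (inv k q); last by exists q.
  have [/= rho0 aw fa _] := iq.
  have [_ /(_ rho rho0)[eta eta0 Heta]] := flow_continuous_open bounds phi_flow a (t0 k) aw.
  have [x' [v [x'y av fx']]] := chain k eta eta0.
  have [|a' a'a fa'] := Heta x'; first by rewrite fa.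
  pose w' := csplice (t k) w v.
  have aw' : admissible w' by exact: admissible_splice.
  have fw' : flow a' w' (t k.+1) = y k.+1.
    have -> : t k.+1 = t k + (t k.+1 - t k) by rewrite addrC subrK.
    by rewrite (flow_splice_after bounds phi_flow)// ?subr_ge0// fa'.
  have [/(_ 1 ltr01)[eta' eta'0 Heta'] _] := flow_continuous_open bounds phi_flow a' (t0 k.+1) aw'.
  exists ((a', Num.min (eta' / 2) (rho - `|a' - a|)), w') => _; split => /=.
  - split => //=; first by rewrite lt_min divr_gt0//= subr_gt0.
    move=> x; rewrite le_min => /andP[h _]; rewrite -fw'; apply/ltW/Heta'; lra.
  - move=> x; rewrite le_min => /andP[_ h].
    by have := ler_normD (x - a') (a' - a); rewrite addrA subrK; lra.
  - by move=> s st; rewrite /splice st.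
pose q := nat_rect (fun=> state) ((y 0%N, 1), w0) (fun k q => nx (k, q)).
have iq k : inv k (q k).
  elim: k => [|k IH] /=; last by have [] := Hnx (k, q k) IH.
  split => //=; rewrite t00; first exact: (flow0 phi_flow).
  by move=> x; rewrite (flow0 phi_flow).
have nest i j : (i <= j)%N -> forall x,
    `|x - (q j).1.1| <= (q j).1.2 -> `|x - (q i).1.1| <= (q i).1.2.
  elim: j => [|j IH]; first by rewrite leqn0 => /eqP ->.
  rewrite leq_eqVlt => /predU1P[->//|]; rewrite ltnS => /IH {}IH x /= h.
  by apply: IH; have [_ + _] := Hnx (j, q j) (iq j); exact.
have ctrl i j s : (i <= j)%N -> s < t i -> (q j).2.1 s = (q i).2.1 s /\ (q j).2.2 s = (q i).2.2 s.
  elim: j => [|j IH]; first by rewrite leqn0 => /eqP ->.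
  rewrite leq_eqVlt => /predU1P[->//|]; rewrite ltnS => ij si.
  have [e1 e2] := IH ij si.
  have [_ _ /(_ s (lt_le_trans si (t_mono _ _ ij)))[e3 e4]] := Hnx (j, q j) (iq j).
  by rewrite /= e3 e4.
have [u su uq] : exists2 v, signals U v & forall k s, s < t k -> v s = (q k).2.1 s.
  apply: signal_limit => [k|i j s si sj]; first by have [_ []] := iq k.
  have [ij|ji] := leqP i j; first by have [e1 e2] := ctrl i j s ij si.
  by have [e1 e2] := ctrl j i s (ltnW ji) sj.
have [d sd dq] : exists2 v, signals D v & forall k s, s < t k -> v s = (q k).2.2 s.
  apply: signal_limit => [k|i j s si sj]; first by have [_ []] := iq k.
  have [ij|ji] := leqP i j; first by have [e1 e2] := ctrl i j s ij si.
  by have [e1 e2] := ctrl j i s (ltnW ji) sj.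
have qB k : `|(q k).1.1| <= `|(q 0%N).1.1| + (q 0%N).1.2.
  have := nest 0%N k (leq0n k) (q k).1.1; rewrite subrr normr0.
  have [/ltW r0 _ _ _] := iq k => /(_ r0).
  have := ler_normD ((q k).1.1 - (q 0%N).1.1) (q 0%N).1.1; rewrite subrK; lra.
have [a ca] := bounded_seq_cluster qB.
exists a, (u, d); split => // k.
have aq : admissible (q k).2 by have [] := iq k.
have -> : flow a (u, d) (t k) = flow a (q k).2 (t k).
  apply: (flow_eq bounds phi_flow) => //; apply: aeW => s /andP[_ st].
  by rewrite /= (uq k s st) (dq k s st).
have [_ _ _] := iq k; apply; apply/ler_addgt0Pr => e e0.
have [j kj ja] := ca e k e0.
have := nest k j kj (q j).1.1; rewrite subrr normr0.
have [/ltW r0 _ _ _] := iq j => /(_ r0).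
have := ler_normD (a - (q j).1.1) ((q j).1.1 - (q k).1.1); rewrite addrA subrK.
by rewrite distrC in ja; lra.
Qed.

Lemma reach_bounded s x : exists e B : R, 0 < e /\
  forall x' w t, `|x' - x| < e -> admissible w -> 0 <= t <= s -> `|flow x' w t| <= B.
Proof.
apply: contrapT => H.
have bx : blows_up_near s x.
  move=> e B e0; apply: contrapT => H'; apply: H; exists e, B; split => // x' w t x'x aw ts.
  by rewrite leNgt; apply/negP => Bf; apply: H'; exists x', w, t.
have [x' [w0 [_ [_ aw0 _ _]]]] := bx 1 0 ltr01.
have [y [t [y0 t0 ts chain yB]]] := blow_up_chain bx.
have [k|a [w [aw shadow]]] := chain_shadowing aw0 t0 _ chain; first by have [] := ts k.
have s0 : 0 <= s by have [h1 h2] := ts 0%N; rewrite t0 in h1; exact: le_trans h2.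
have [B HB] := ac_bounded s0 (flow_trajectory phi_flow a s (lexx 0) aw).1.
have [k] := yB (B + 1).
have tk : 0 <= t k <= s.
  apply/andP; split.
    by elim: k => [|k IH]; [rewrite t0|apply: le_trans IH _; have [] := ts k].
  by case: k => [|k]; [rewrite t0|have [] := ts k].
have := HB _ tk; have := shadow k.
have := ler_normD (y k - flow a w (t k)) (flow a w (t k)); rewrite subrK distrC; lra.
Qed.

Lemma flow_lipschitz_near s x : exists e B C : R, [/\ 0 < e, 0 <= C &
  forall x' w t, `|x' - x| < e -> admissible w -> 0 <= t <= s ->
    `|flow x' w t| <= B /\ `|flow x' w t - flow x w t| <= C * `|x' - x|].
Proof.
have [e [B [e0 HB]]] := reach_bounded s x.
have [M [L ML]] := bounds B; have L0 : 0 <= L by have [_ /ltW] := ML.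
pose N := (Num.truncn (2 * (L * `|s|))).+1.
exists e, B, (2 ^+ N); split => // x' w t x'x aw /andP[t0 ts]; split.
  by apply: HB => //; rewrite t0.
have xx : `|x - x| < e by rewrite subrr normr0.
have zb : linear_growth (fun t => flow x' w t - flow x w t) L 0 t.
  apply: (trajectory_diff t0 (lexx 0) aw (aeW _ _) _ _ ML).
  - by [].
  - exact: (flow_trajectory phi_flow).
  - exact: (flow_trajectory phi_flow).
  - by move=> q /andP[q0 qt]; apply: HB => //; rewrite q0 (le_trans qt).
  - by move=> q /andP[q0 qt]; apply: HB => //; rewrite q0 (le_trans qt).
have := gronwall L0 (N := N) t0 zb; rewrite !(flow0 phi_flow)//; apply.
rewrite subr0 ler_pdivlMr// mulrC; apply/ltW; apply: le_lt_trans (truncnS_gt _).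
rewrite ler_pM2l// ler_wpM2l//; apply: le_trans ts (ler_norm _).
Qed.

End ReachBounded.

(** * Strategies and game values *)

Section Strategies.
Context {R : realType} {k j : nat} (A : set 'rV[R]_k) (B : set 'rV[R]_j).
Notation leb := (@lebesgue_measure R).
Implicit Types (a : R -> 'rV[R]_k) (b : R -> 'rV[R]_j).

Lemma strategy_reply al a : strategies A B al -> signals A a -> signals B (al a).
Proof. by move=> [+ _]; exact. Qed.

Lemma strategy_cst b : signals B b -> strategies A B (fun=> b).
Proof. by move=> sb; split => // s a1 a2 _ _ _ _; exact: aeW. Qed.

Lemma splice_ae_equal c s (a0 a1 a2 : R -> 'rV[R]_k) : 0 <= c ->
  ae_equal_until s a1 a2 ->
  ae_equal_until (c + s) (splice c a0 a1) (splice c a0 a2).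
Proof.
move=> c0 h; apply: ae_imply (ae_translate (- c) h) => t + /andP[t0 tcs].
rewrite /splice; case: ltP => // ct; rewrite addrC; apply.
by rewrite subr_ge0 ct lerBlDl.
Qed.

Lemma splice_ae_equal_before c (a0 a1 a2 : R -> 'rV[R]_k) :
  ae_equal_until c (splice c a0 a1) (splice c a0 a2).
Proof.
apply: ae_imply (ae_neq c) => t tc /andP[_ tlc].
by rewrite /splice lt_neqAle tlc andbT; move/eqP: tc => ->.
Qed.

Lemma tail_ae_equal (q : nat) c s (b1 b2 : R -> 'rV[R]_q) : 0 <= c ->
  ae_equal_until (c + s) b1 b2 -> ae_equal_until s (tail c b1) (tail c b2).
Proof.
move=> c0 h; apply: ae_imply (ae_translate c h) => t + /andP[t0 ts]; apply.
by rewrite addr_ge0//= lerD2l.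
Qed.

Lemma strategy_tail al c a0 : 0 <= c -> strategies A B al -> signals A a0 ->
  strategies A B (fun a => tail c (al (splice c a0 a))).
Proof.
move=> c0 sal sa0; split.
  by move=> a sa; apply: signal_tail => //; apply: strategy_reply => //; exact: signal_splice.
move=> s a1 a2 s0 sa1 sa2 a12; apply: tail_ae_equal => //.
have [_] := sal; apply; rewrite ?addr_ge0//; [exact: signal_splice..|].
exact: splice_ae_equal.
Qed.

(** The strategy al y followed after time c may depend on y without any
    regularity: for each single signal only one of these strategies is used. *)
Lemma strategy_splice (X : Type) (c : R) sg (st : (R -> 'rV[R]_k) -> X)
    (al : X -> (R -> 'rV[R]_k) -> (R -> 'rV[R]_j)) : 0 <= c ->
  strategies A B sg -> (forall y, strategies A B (al y)) ->
  (forall a1 a2, signals A a1 -> signals A a2 -> ae_equal_until c a1 a2 ->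
     st a1 = st a2) ->
  strategies A B (fun a => splice c (sg a) (al (st a) (tail c a))).
Proof.
move=> c0 ssg sal st_ae; split.
  move=> a sa; apply: signal_splice => //; first exact: strategy_reply.
  by apply: strategy_reply => //; exact: signal_tail.
move=> s a1 a2 s0 sa1 sa2 a12.
have [sc|cs] := ltP s c.
  have [_ /(_ s a1 a2 s0 sa1 sa2 a12)] := ssg; apply: ae_imply => t + /andP[t0 ts].
  by rewrite /splice (le_lt_trans ts sc); apply; rewrite t0.
have a12c : ae_equal_until c a1 a2.
  apply: ae_imply a12 => t + /andP[t0 tc]; apply; rewrite t0; exact: le_trans cs.
rewrite (st_ae a1 a2)//.
have [_ /(_ c a1 a2 c0 sa1 sa2 a12c) h1] := ssg.
have [_ /(_ (s - c) (tail c a1) (tail c a2)) h2] := sal (st a2).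
have {}h2 : ae_equal_until (s - c) (al (st a2) (tail c a1)) (al (st a2) (tail c a2)).
  apply: h2; [by rewrite subr_ge0|exact: signal_tail|exact: signal_tail|].
  by apply: tail_ae_equal => //; rewrite addrC subrK.
have h3 := ae_translate (- c) h2.
apply: ae_imply2 h1 h3 => t H1 H3 /andP[t0 ts]; rewrite /splice; case: ltP => ct.
  by apply: H1; rewrite t0 ltW.
by rewrite addrC; apply: H3; rewrite addrC subr_ge0 ct lerD2r.
Qed.

Section value.
Context (X : Type) (K : X -> (R -> 'rV[R]_k) -> (R -> 'rV[R]_j) -> R) (M : R).
Hypothesis KM : forall y a b, `|K y a b| <= M.
Hypotheses (A0 : A !=set0) (B0 : B !=set0).

Definition game_value y := inf [set sup [set K y a (al a) | a in signals A]
  | al in strategies A B].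

Let signalA : signals A !=set0.
Proof. by have [p Ap] := A0; exists (fun=> p); exact: signal_cst. Qed.

Let stratAB : strategies A B !=set0.
Proof.
have [p Bp] := B0; exists (fun=> fun=> p); apply: strategy_cst; exact: signal_cst.
Qed.

Let has_sup_reply y al : has_sup [set K y a (al a) | a in signals A].
Proof.
split; first by have [a sa] := signalA; exists (K y a (al a)), a.
by exists M => _ [a _ <-]; apply: le_trans (ler_norm _) (KM _ _ _).
Qed.

Let sup_reply_ge y al : - M <= sup [set K y a (al a) | a in signals A].
Proof.
have [a sa] := signalA; apply: (@le_trans _ _ (K y a (al a))).
  by have := KM y a (al a); rewrite ler_norml => /andP[].
by apply: ub_le_sup; [case: (has_sup_reply y al)|exists a].
Qed.

Let has_inf_value y : has_inf [set sup [set K y a (al a) | a in signals A]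
  | al in strategies A B].
Proof.
split; first by have [al sal] := stratAB; exists (sup [set K y a (al a) | a in signals A]), al.
by exists (- M) => _ [al _ <-].
Qed.

Lemma game_value_le y al c : strategies A B al ->
  (forall a, signals A a -> K y a (al a) <= c) -> game_value y <= c.
Proof.
move=> sal H; apply: (@le_trans _ _ (sup [set K y a (al a) | a in signals A])).
  by apply: ge_inf; [case: (has_inf_value y)|exists al].
by apply: ge_sup => [|_ [a sa <-]]; [case: (has_sup_reply y al)|exact: H].
Qed.

Lemma game_value_ge y c : (forall al (e : R), strategies A B al -> 0 < e ->
   exists2 a, signals A a & c - e <= K y a (al a)) -> c <= game_value y.
Proof.
move=> H; apply: lb_le_inf; first by case: (has_inf_value y).
move=> _ [al sal <-]; apply/ler_addgt0Pr => e e0.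
have [a sa] := H al e sal e0; rewrite lerBlDr => /le_trans; apply; rewrite lerD2r.
by apply: ub_le_sup; [case: (has_sup_reply y al)|exists a].
Qed.

Lemma game_value_strategy y (e : R) : 0 < e -> exists2 al, strategies A B al &
  forall a, signals A a -> K y a (al a) <= game_value y + e.
Proof.
move=> e0; have [_ [al sal <-] H] := inf_adherent e0 (has_inf_value y).
exists al => // a sa; apply: le_trans (ltW H).
by apply: ub_le_sup; [case: (has_sup_reply y al)|exists a].
Qed.

Lemma game_value_response y al (e : R) : strategies A B al -> 0 < e ->
  exists2 a, signals A a & game_value y - e <= K y a (al a).
Proof.
move=> sal e0; have [_ [a sa <-] H] := sup_adherent e0 (has_sup_reply y al).
exists a => //; apply: le_trans (ltW H); rewrite lerD2r.
by apply: ge_inf; [case: (has_inf_value y)|exists al].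
Qed.

Lemma game_value_norm y : `|game_value y| <= M.
Proof.
rewrite ler_norml; apply/andP; split.
  by apply: lb_le_inf; [case: (has_inf_value y)|move=> _ [al _ <-]].
have [al sal] := stratAB; apply: (game_value_le sal) => a _.
exact: le_trans (ler_norm _) (KM _ _ _).
Qed.

Lemma game_value_close y y' e : 
  (forall a b, signals A a -> signals B b -> K y' a b <= K y a b + e) ->
  game_value y' <= game_value y + e.
Proof.
move=> H; apply/ler_addgt0Pr => e1 e10.
have [al sal Hal] := game_value_strategy y e10.
apply: (game_value_le sal) => a sa.
have := H a (al a) sa (strategy_reply sal sa); have := Hal a sa; lra.
Qed.

(** The first player uses a0 up to time tau, whatever the strategy al of the
    opponent, and answers from time tau on to the strategy that al induces against
    signals starting with a0. *)
Lemma game_value_ge_open_loop y c (tau : R) a0 (st : (R -> 'rV[R]_j) -> X) :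
  0 <= tau -> signals A a0 ->
  (forall b b', signals B b -> signals B b' -> ae_equal_until tau b b' -> st b = st b') ->
  (forall a b e, signals A a -> signals B b -> 0 < e ->
     game_value (st b) - e <= K (st b) a (tail tau b) ->
     c - e <= K y (splice tau a0 a) b) ->
  c <= game_value y.
Proof.
move=> tau0 sa0 st_ae H; apply: game_value_ge => al e sal e0.
have [a sa Ha] := game_value_response (st (al (splice tau a0 a0)))
  (strategy_tail tau0 sal sa0) e0.
have sp a' : signals A a' -> signals A (splice tau a0 a') by exact: signal_splice.
exists (splice tau a0 a); first exact: sp.
apply: H => //; first exact: strategy_reply (sp _ sa).
rewrite (st_ae _ (al (splice tau a0 a0)))//; [exact: strategy_reply (sp _ sa)|
  exact: strategy_reply (sp _ sa0)|].
have [_] := sal; apply => //; [exact: sp..|exact: splice_ae_equal_before].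
Qed.

(** The second player follows sg up to time tau, and then a strategy that is
    nearly optimal for the state st a reached at that time. *)
Lemma game_value_le_strategy y c (tau : R) sg (st : (R -> 'rV[R]_k) -> X) :
  0 <= tau -> strategies A B sg ->
  (forall a a', signals A a -> signals A a' -> ae_equal_until tau a a' -> st a = st a') ->
  (forall a b e, signals A a -> signals B b -> 0 < e ->
     K (st a) (tail tau a) b <= game_value (st a) + e ->
     K y a (splice tau (sg a) b) <= c + e) ->
  game_value y <= c.
Proof.
move=> tau0 ssg st_ae H; apply/ler_addgt0Pr => e e0.
(* one tolerance e serves all states z at once *)
have /choice[al Hal] : forall z, exists al, strategies A B al /\
    forall a, signals A a -> K z a (al a) <= game_value z + e.
  by move=> z; have [al ? ?] := game_value_strategy z e0; exists al.
apply: (@game_value_le _ (fun a => splice tau (sg a) (al (st a) (tail tau a)))).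
  by apply: strategy_splice => // z; have [] := Hal z.
move=> a sa; have [sal Ka] := Hal (st a); have sta : signals A (tail tau a) by exact: signal_tail.
by apply: H => //; [exact: strategy_reply|exact: Ka].
Qed.

End value.
End Strategies.

(** * The discounted payoff *)

Lemma continuous_modulus (R : realType) (V W : normedModType R) (F : V -> W) :
  (forall x (e : R), 0 < e -> exists2 eta : R, 0 < eta &
     forall x', `|x' - x| < eta -> `|F x' - F x| <= e) -> continuous F.
Proof.
move=> H x; apply/cvgrPdist_le => e e0.
have [eta eta0 Heta] := H x e e0; near=> x'.
rewrite distrC; apply: Heta; rewrite distrC; near: x'; exact: cvgr_dist_lt.
Unshelve. all: by end_near. Qed.

Lemma expR_small (R : realType) (g q : R) : 0 < g -> 0 < q ->
  exists2 T : R, 0 <= T & forall t, T <= t -> expR (- g * t) <= q.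
Proof.
move=> g0 q0; exists (Num.max 0 (- ln q / g)); first by rewrite le_max lexx.
move=> t; rewrite ge_max => /andP[_ h].
rewrite -(lnK q0) ler_expR; move: h; rewrite ler_pdivrMr//; lra.
Qed.

Section Payoff.
Context {R : realType} {n m l : nat}.
Context (U : set 'rV[R]_m) (D : set 'rV[R]_l)
  (f : 'rV[R]_n -> 'rV[R]_m -> 'rV[R]_l -> 'rV[R]_n)
  (phi : 'rV[R]_n -> (R -> 'rV[R]_m) -> (R -> 'rV[R]_l) -> R -> 'rV[R]_n)
  (h : 'rV[R]_n -> R) (gamma Mh : R).
Hypothesis bounds : forall r, exists M L, speed_bounds U D f r M L.
Hypothesis phi_flow : solution_flow U D f phi.
Hypothesis hM : forall x, `|h x| <= Mh.
Hypothesis gamma_gt0 : 0 < gamma.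
Notation flow := (flow phi).
Notation admissible := (admissible U D).
Notation J := (payoff phi h gamma).

Lemma discount_le1 t : 0 <= t -> expR (- gamma * t) <= 1.
Proof. by move=> t0; rewrite expR_le1 mulNr oppr_le0 mulr_ge0// ltW. Qed.

Lemma discounted_norm t x : 0 <= t -> `|expR (- gamma * t) * h x| <= Mh.
Proof.
move=> t0; rewrite normrM ger0_norm ?expR_ge0//; apply: le_trans (hM x).
by rewrite ler_piMl// discount_le1.
Qed.

Let ne x u d : [set expR (- gamma * t) * h (phi x u d t) | t in `[0, +oo[%classic] !=set0.
Proof. by exists (expR (- gamma * 0) * h (phi x u d 0)), 0 => //=; rewrite in_itv/= lexx. Qed.

Lemma payoff_ge x u d t : 0 <= t -> expR (- gamma * t) * h (phi x u d t) <= J x u d.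
Proof.
move=> t0; apply: ub_le_sup; last by exists t => //=; rewrite in_itv/= t0.
exists Mh => _ [s /= + <-]; rewrite in_itv/= andbT => s0.
exact: le_trans (ler_norm _) (discounted_norm _ s0).
Qed.

Lemma payoff_le x u d c :
  (forall t, 0 <= t -> expR (- gamma * t) * h (phi x u d t) <= c) -> J x u d <= c.
Proof.
move=> H; apply: ge_sup => // _ [t /= + <-]; rewrite in_itv/= andbT; exact: H.
Qed.

Lemma payoff_norm x u d : `|J x u d| <= Mh.
Proof.
rewrite ler_norml; apply/andP; split.
  apply: le_trans (payoff_ge x u d (lexx 0)).
  by have := discounted_norm (phi x u d 0) (lexx 0); rewrite ler_norml => /andP[].
by apply: payoff_le => t t0; apply: le_trans (ler_norm _) (discounted_norm _ t0).
Qed.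

Lemma payoff_ge_obstacle x u d : admissible (u, d) -> h x <= J x u d.
Proof.
move=> aw; apply: le_trans (payoff_ge x u d (lexx 0)).
by rewrite mulr0 expR0 mul1r -[phi x u d 0]/(flow x (u, d) 0) (flow0 phi_flow).
Qed.

Section split.
Context (x : 'rV[R]_n) (w w0 w1 : control (R:=R) (m:=m) (l:=l)) (tau : R).
Hypotheses (tau0 : 0 <= tau) (aw : admissible w) (aw0 : admissible w0) (aw1 : admissible w1).
Hypothesis before : forall t, 0 <= t < tau -> w.1 t = w0.1 t /\ w.2 t = w0.2 t.
Hypothesis after : forall t, 0 <= t -> w.1 (tau + t) = w1.1 t /\ w.2 (tau + t) = w1.2 t.

Lemma split_flow_before t : 0 <= t <= tau -> flow x w t = flow x w0 t.
Proof.
move=> /andP[t0 tt]; apply: (flow_eq bounds phi_flow) => //.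
by apply: aeW => s /andP[/ltW s0 st]; apply: before; rewrite s0 (lt_le_trans st).
Qed.

Lemma split_flow_after t : 0 <= t -> flow x w (tau + t) = flow (flow x w0 tau) w1 t.
Proof.
move=> t0; rewrite -(flow_tail bounds phi_flow)// split_flow_before ?tau0 ?lexx//.
apply: (flow_eq bounds phi_flow) => //; first exact: admissible_tail.
by apply: aeW => s /andP[/ltW s0 _]; rewrite /= /tail; have [-> ->] := after s0.
Qed.

Lemma payoff_split_ge :
  expR (- gamma * tau) * J (flow x w0 tau) w1.1 w1.2 <= J x w.1 w.2.
Proof.
rewrite mulrC -ler_pdivlMr ?expR_gt0//; apply: payoff_le => t t0.
rewrite ler_pdivlMr ?expR_gt0// mulrAC -expRD -mulrDr addrC.
rewrite -[phi _ _ _ t]/(flow (flow x w0 tau) w1 t) -split_flow_after//.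
by apply: payoff_ge; rewrite addr_ge0.
Qed.

(** The payoff is the larger of the supremum over [0, tau] and the discounted
    payoff of the continuation. *)
Lemma payoff_split_le c :
  (forall t, 0 <= t <= tau -> expR (- gamma * t) * h (flow x w0 t) <= c) ->
  expR (- gamma * tau) * J (flow x w0 tau) w1.1 w1.2 <= c -> J x w.1 w.2 <= c.
Proof.
move=> H1 H2; apply: payoff_le => t t0; rewrite -[phi _ _ _ t]/(flow x w t).
have [tt|tt] := leP t tau; first by rewrite split_flow_before ?t0// H1// t0.
have -> : t = tau + (t - tau) by rewrite addrC subrK.
have tt0 : 0 <= t - tau by rewrite subr_ge0 ltW.
rewrite split_flow_after//; apply: le_trans H2.
rewrite mulrDr expRD -mulrA ler_wpM2l ?expR_ge0//.
exact: payoff_ge.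
Qed.

End split.

(** After a time T the discount makes the payoff negligible as h is bounded; up to
    time T the flow is Lipschitz in the initial state, uniformly in the controls,
    and stays in a ball on which h is Lipschitz. *)
Lemma payoff_continuous : locally_lipschitz h -> forall x (e : R), 0 < e ->
  exists2 eta : R, 0 < eta & forall x', `|x' - x| < eta ->
    forall u d, admissible (u, d) -> `|J x' u d - J x u d| <= e.
Proof.
move=> lh x e e0.
have Mh0 : 0 <= Mh by apply: le_trans (hM 0).
have q0 : 0 < e / (2 * Mh + 1) by rewrite divr_gt0//; lra.
have [T T0 HT] := expR_small gamma_gt0 q0.
have [e1 [B [C [e10 C0 HB]]]] := flow_lipschitz_near bounds phi_flow T x.
have [L L0 HL] : exists2 L : R, 0 < L & forall y z : 'rV[R]_n, `|y| <= B -> `|z| <= B ->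
    `|h y - h z| <= L * `|y - z|.
  have cB : compact [set y : 'rV[R]_n | `|y - 0| <= B] by exact: compact_rV_ball.
  have lh' : locally_lipschitz_uniformly [set: unit] [set: unit]
      (fun (y : 'rV[R]_n) (_ _ : unit) => h y).
    by move=> y; have [k [N ? ?]] := lh y; exists k, N.
  have [L L0 HL] := lipschitz_on_compact cB lh' (fun y _ _ _ _ _ => hM y).
  by exists L => // y z yB zB; apply: (HL y z tt tt) => //=; rewrite subr0.
have LC0 : 0 < L * C + 1 by rewrite ltr_wpDl// mulr_ge0// ltW.
exists (Num.min e1 (e / (L * C + 1))); first by rewrite lt_min e10 divr_gt0.
move=> x'; rewrite lt_min => /andP[x'1 x'e] u d aw.
have xx : `|x - x| < e1 by rewrite subrr normr0.
have close t : 0 <= t -> `|expR (- gamma * t) * h (phi x' u d t) -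
    expR (- gamma * t) * h (phi x u d t)| <= e.
  move=> t0; rewrite -mulrBr normrM ger0_norm ?expR_ge0//.
  have [tT|Tt] := leP t T.
    have tT' : 0 <= t <= T by rewrite t0.
    have [b1 d1] := HB x' (u, d) t x'1 aw tT'; have [b2 _] := HB x (u, d) t xx aw tT'.
    apply: (@le_trans _ _ (1 * (L * (C * `|x' - x|)))).
      apply: ler_pM; rewrite ?expR_ge0//; first exact: discount_le1.
      by apply: le_trans (HL _ _ b1 b2) _; rewrite ler_pM2l.
    rewrite mul1r mulrA; move: x'e; rewrite ltr_pdivlMr//.
    have := normr_ge0 (x' - x); lra.
  have hh := ler_normB (h (phi x' u d t)) (h (phi x u d t)).
  have h1 := hM (phi x' u d t); have h2 := hM (phi x u d t).
  apply: (@le_trans _ _ (e / (2 * Mh + 1) * (2 * Mh + 1))).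
    apply: ler_pM; rewrite ?expR_ge0//; first exact: HT (ltW Tt).
    lra.
  by rewrite divfK// gt_eqF//; lra.
rewrite ler_norml; apply/andP; split.
  rewrite lerBrDl -lerBrDr; apply: payoff_le => t t0.
  have := close t t0; rewrite ler_norml => /andP[h1 h2].
  have := payoff_ge x' u d t0; lra.
rewrite lerBlDl; apply: payoff_le => t t0.
have := close t t0; rewrite ler_norml => /andP[h1 h2].
have := payoff_ge x u d t0; lra.
Qed.

End Payoff.

(** * Dynamic programming *)

Section DynamicProgramming.
Context {R : realType} {n m l : nat}.
Context (U : set 'rV[R]_m) (D : set 'rV[R]_l)
  (f : 'rV[R]_n -> 'rV[R]_m -> 'rV[R]_l -> 'rV[R]_n)
  (phi : 'rV[R]_n -> (R -> 'rV[R]_m) -> (R -> 'rV[R]_l) -> R -> 'rV[R]_n)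
  (h : 'rV[R]_n -> R) (gamma Mh : R).
Hypothesis bounds : forall r, exists M L, speed_bounds U D f r M L.
Hypothesis phi_flow : solution_flow U D f phi.
Hypothesis hM : forall x, `|h x| <= Mh.
Hypothesis gamma_gt0 : 0 < gamma.
Hypotheses (U0 : U !=set0) (D0 : D !=set0).
Notation flow := (flow phi).
Notation admissible := (admissible U D).
Notation J := (payoff phi h gamma).
Notation Vlow := (lower_value U D phi h gamma).
Notation Vup := (upper_value U D phi h gamma).
Notation disc t := (expR (- gamma * t)).

Definition lower_game (x : 'rV[R]_n) (d : R -> 'rV[R]_l) (u : R -> 'rV[R]_m) := J x u d.
(** In [game_value] the player with strategies minimizes.  In the upper game this
    player is d, who maximizes the payoff, hence the sign; the upper value is the
    opposite of the value of this game. *)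
Definition upper_game (x : 'rV[R]_n) (u : R -> 'rV[R]_m) (d : R -> 'rV[R]_l) := - J x u d.

Lemma lower_valueE x : Vlow x = game_value D U lower_game x.
Proof. by []. Qed.

Lemma upper_valueE x : Vup x = - game_value U D upper_game x.
Proof.
rewrite /game_value /inf opprK /upper_value; congr sup.
rewrite image_comp; apply: eq_imagel => be _ /=.
by rewrite /inf image_comp.
Qed.

Let lowM x d u : `|lower_game x d u| <= Mh.
Proof. exact: payoff_norm. Qed.

Let upM x u d : `|upper_game x u d| <= Mh.
Proof. by rewrite normrN; exact: payoff_norm. Qed.

Let disc_slack tau c v e : 0 <= tau -> 0 < e -> c <= disc tau * v ->
  c - e <= disc tau * (v - e).
Proof.
move=> t0 e0 cv; rewrite mulrBr.
have : disc tau * e <= 1 * e by apply: ler_wpM2r; [exact: ltW|exact: discount_le1].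
lra.
Qed.

Let disc_slack_le tau c v e : 0 <= tau -> 0 < e -> disc tau * v <= c ->
  disc tau * (v + e) <= c + e.
Proof.
move=> t0 e0 cv; rewrite mulrDr.
have : disc tau * e <= 1 * e by apply: ler_wpM2r; [exact: ltW|exact: discount_le1].
lra.
Qed.

(** The player d acts first, with d0 up to time tau. *)
Lemma lower_dpp_ge x tau d0 c : 0 <= tau -> signals D d0 ->
  (forall u, signals U u -> c <= disc tau * Vlow (flow x (u, d0) tau)) -> c <= Vlow x.
Proof.
move=> t0 sd0 H; rewrite lower_valueE.
apply: (game_value_ge_open_loop lowM D0 U0 (st := fun u => flow x (u, d0) tau) t0 sd0).
  move=> u u' su su' uu'; apply: (flow_eq bounds phi_flow) => //.
  by apply: ae_imply uu' => t + /andP[s0 st] /=; move=> ->//; rewrite !ltW.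
move=> d u e sd su e0; rewrite -lower_valueE => Hd.
apply: le_trans (disc_slack t0 e0 (H u su)) _.
have ge_tail : disc tau * lower_game (flow x (u, d0) tau) d (tail tau u) <=
    lower_game x (splice tau d0 d) u; last first.
  by apply: le_trans ge_tail; rewrite ler_wpM2l// expR_ge0.
apply: (payoff_split_ge bounds phi_flow hM gamma_gt0 x (w := (u, splice tau d0 d))
  (w0 := (u, d0)) (w1 := (tail tau u, d)) t0) => //.
- by split => //=; exact: signal_splice.
- by split => //=; exact: signal_tail.
- by move=> t /andP[_ tt]; rewrite /= /splice tt.
- by move=> t tt /=; rewrite -[splice _ _ _ _]/(tail tau (splice tau d0 d) t) tail_splice.
Qed.

Lemma lower_dpp_le x tau sg c : 0 <= tau -> strategies D U sg ->
  (forall d, signals D d ->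
     (forall t, 0 <= t <= tau -> disc t * h (flow x (sg d, d) t) <= c) /\
     disc tau * Vlow (flow x (sg d, d) tau) <= c) -> Vlow x <= c.
Proof.
move=> t0 ssg H; rewrite lower_valueE.
apply: (game_value_le_strategy lowM D0 U0 (st := fun d => flow x (sg d, d) tau) t0 ssg).
  move=> d d' sd sd' dd'; apply: (flow_eq bounds phi_flow) => //.
  - by split => //=; exact: strategy_reply ssg _.
  - by split => //=; exact: strategy_reply ssg _.
  - have [_ /(_ tau d d' t0 sd sd' dd')] := ssg.
    apply: (ae_imply2 _ dd') => t e1 e2 /andP[s0 st] /=.
    by rewrite e1 ?e2// !ltW.
move=> d u e sd su e0; rewrite -lower_valueE => Hd; have [H1 H2] := H d sd.
have asg : admissible (sg d, d) by split => //=; exact: strategy_reply ssg _.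
apply: (payoff_split_le bounds phi_flow hM gamma_gt0 (w := (splice tau (sg d) u, d))
  (w0 := (sg d, d)) (w1 := (u, tail tau d)) t0 _ asg) => //.
- by split => //=; apply: signal_splice => //; exact: strategy_reply ssg _.
- by split => //=; exact: signal_tail.
- by move=> t /andP[_ tt]; rewrite /= /splice tt.
- by move=> t tt /=; rewrite -[splice _ _ _ _]/(tail tau (splice tau (sg d) u) t) tail_splice.
- by move=> t /H1 /le_trans; apply; rewrite lerDl ltW.
- apply: le_trans (disc_slack_le t0 e0 H2).
  by rewrite ler_wpM2l// expR_ge0.
Qed.

Lemma upper_dpp_ge x tau sg c : 0 <= tau -> strategies U D sg ->
  (forall u, signals U u -> c <= disc tau * Vup (flow x (u, sg u) tau)) -> c <= Vup x.
Proof.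
move=> t0 ssg H; rewrite upper_valueE lerNr.
apply: (game_value_le_strategy upM U0 D0 (st := fun u => flow x (u, sg u) tau) t0 ssg).
  move=> u u' su su' uu'; apply: (flow_eq bounds phi_flow) => //.
  - by split => //=; exact: strategy_reply ssg _.
  - by split => //=; exact: strategy_reply ssg _.
  - have [_ /(_ tau u u' t0 su su' uu')] := ssg.
    apply: (ae_imply2 _ uu') => t e1 e2 /andP[s0 st] /=.
    by rewrite e1 ?e2// !ltW.
move=> u d e su sd e0.
rewrite -[game_value _ _ _ _]opprK -upper_valueE /upper_game => Hd.
rewrite lerNl opprD opprK.
have asg : admissible (u, sg u) by split => //=; exact: strategy_reply ssg _.
apply: le_trans (disc_slack t0 e0 (H u su)) _.
have ge_tail : disc tau * J (flow x (u, sg u) tau) (tail tau u) d <=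
    J x u (splice tau (sg u) d); last first.
  by apply: le_trans ge_tail; rewrite ler_wpM2l ?expR_ge0//=; lra.
apply: (payoff_split_ge bounds phi_flow hM gamma_gt0 x (w := (u, splice tau (sg u) d))
  (w0 := (u, sg u)) (w1 := (tail tau u, d)) t0 _ asg) => //.
- by split => //=; apply: signal_splice => //; exact: strategy_reply ssg _.
- by split => //=; exact: signal_tail.
- by move=> t /andP[_ tt]; rewrite /= /splice tt.
- by move=> t tt /=; rewrite -[splice _ _ _ _]/(tail tau (splice tau (sg u) d) t) tail_splice.
Qed.

Lemma upper_dpp_le x tau u0 c : 0 <= tau -> signals U u0 ->
  (forall d, signals D d ->
     (forall t, 0 <= t <= tau -> disc t * h (flow x (u0, d) t) <= c) /\
     disc tau * Vup (flow x (u0, d) tau) <= c) -> Vup x <= c.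
Proof.
move=> t0 su0 H; rewrite upper_valueE lerNl.
apply: (game_value_ge_open_loop upM U0 D0 (st := fun d => flow x (u0, d) tau) t0 su0).
  move=> d d' sd sd' dd'; apply: (flow_eq bounds phi_flow) => //.
  by apply: ae_imply dd' => t + /andP[s0 st] /=; move=> ->//; rewrite !ltW.
move=> u d e su sd e0.
rewrite -[game_value _ _ _ _]opprK -upper_valueE /upper_game => Hd.
rewrite lerNr opprB opprK addrC; have [H1 H2] := H d sd.
apply: (payoff_split_le bounds phi_flow hM gamma_gt0 (w := (splice tau u0 u, d))
  (w0 := (u0, d)) (w1 := (u, tail tau d)) t0) => //.
- by split => //=; exact: signal_splice.
- by split => //=; exact: signal_tail.
- by move=> t /andP[_ tt]; rewrite /= /splice tt.
- by move=> t tt /=; rewrite -[splice _ _ _ _]/(tail tau (splice tau u0 u) t) tail_splice.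
- by move=> t /H1 /le_trans; apply; rewrite lerDl ltW.
- apply: le_trans (disc_slack_le t0 e0 H2).
  by rewrite ler_wpM2l ?expR_ge0//=; lra.
Qed.

Lemma obstacle_le_lower x : h x <= Vlow x.
Proof.
rewrite lower_valueE; apply: (game_value_ge lowM D0 U0) => al e sal e0.
have [p Dp] := D0; exists (fun=> p); first exact: signal_cst.
have : h x <= J x (al (fun=> p)) (fun=> p).
  apply: (payoff_ge_obstacle phi_flow hM gamma_gt0); split => /=; last exact: signal_cst.
  by apply: strategy_reply sal _; exact: signal_cst.
by rewrite /lower_game; lra.
Qed.

Lemma obstacle_le_upper x : h x <= Vup x.
Proof.
rewrite upper_valueE lerNr; have [p Dp] := D0.
apply: (game_value_le upM U0 D0 (al := fun=> fun=> p)).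
  by apply: strategy_cst; exact: signal_cst.
move=> u su; rewrite lerN2; apply: (payoff_ge_obstacle phi_flow hM gamma_gt0).
by split => //=; exact: signal_cst.
Qed.

Lemma lower_value_norm x : `|Vlow x| <= Mh.
Proof. by rewrite lower_valueE; exact: (game_value_norm lowM D0 U0). Qed.

Lemma upper_value_norm x : `|Vup x| <= Mh.
Proof. by rewrite upper_valueE normrN; exact: (game_value_norm upM U0 D0). Qed.

Lemma lower_value_continuous : locally_lipschitz h -> continuous Vlow.
Proof.
move=> lh; apply: continuous_modulus => x e e0.
have [eta eta0 Heta] := payoff_continuous bounds phi_flow hM gamma_gt0 lh x e0.
exists eta => // x' x'x; rewrite ler_norml; apply/andP; split.
  rewrite lerBrDl -lerBrDr opprK !lower_valueE; apply: (game_value_close lowM D0 U0) => d u sd su.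
  have := Heta x' x'x u d (conj su sd); rewrite ler_norml /lower_game; lra.
rewrite lerBlDl !lower_valueE; apply: (game_value_close lowM D0 U0) => d u sd su.
have := Heta x' x'x u d (conj su sd); rewrite ler_norml /lower_game; lra.
Qed.

Lemma upper_value_continuous : locally_lipschitz h -> continuous Vup.
Proof.
move=> lh; apply: continuous_modulus => x e e0.
have [eta eta0 Heta] := payoff_continuous bounds phi_flow hM gamma_gt0 lh x e0.
exists eta => // x' x'x; rewrite !upper_valueE.
have h1 : game_value U D upper_game x <= game_value U D upper_game x' + e.
  apply: (game_value_close upM U0 D0) => u d su sd.
  have := Heta x' x'x u d (conj su sd); rewrite ler_norml /upper_game; lra.
have h2 : game_value U D upper_game x' <= game_value U D upper_game x + e.
  apply: (game_value_close upM U0 D0) => u d su sd.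
  have := Heta x' x'x u d (conj su sd); rewrite ler_norml /upper_game; lra.
rewrite ler_norml; lra.
Qed.

End DynamicProgramming.

(** * First-order expansions *)

Lemma finite_family_equicontinuous (R : realType) (V : normedModType R) (I : finType)
    (F : I -> V -> R) x0 (e : R) : (forall i, continuous (F i)) -> 0 < e ->
  exists2 eta : R, 0 < eta & forall i x, `|x - x0| < eta -> `|F i x - F i x0| <= e.
Proof.
move=> cF e0.
have /nbhs_ballP[eta /= eta0 Heta] : \forall x \near x0, forall i, `|F i x - F i x0| <= e.
  apply: filter_forall => i.
  by have /cvgrPdist_le/(_ _ e0) := cF i x0; apply: filterS => x; rewrite distrC.
by exists eta => // i x xx0; apply: Heta; rewrite -ball_normE/= distrC.
Qed.

Section Dot.
Context {R : realType} {n : nat}.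
Implicit Types (p q : 'rV[R]_n).

Definition norm1 p := \sum_(i < n) `|p 0 i|.

Lemma norm1_ge0 p : 0 <= norm1 p.
Proof. by apply: sumr_ge0. Qed.

Lemma coord_norm q i : `|q 0 i| <= `|q|.
Proof. by rewrite [leRHS]/Num.norm /= mx_normrE; apply: le_trans (le_bigmax _ _ (0, i)). Qed.

Lemma norm_le_coord q (B : R) : 0 <= B -> (forall i, `|q 0 i| <= B) -> `|q| <= B.
Proof.
move=> B0 qB; rewrite [leLHS]/Num.norm /= mx_normrE; apply: bigmax_le => // -[i j] _ /=.
by rewrite ord1.
Qed.

Lemma dotp_norm p q : `|dotp p q| <= norm1 p * `|q|.
Proof.
apply: le_trans (ler_norm_sum _ _ _) _; rewrite mulr_suml; apply: ler_sum => i _.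
by rewrite normrM ler_wpM2l// coord_norm.
Qed.

Lemma dotpDr p q q' : dotp p (q + q') = dotp p q + dotp p q'.
Proof. by rewrite -big_split; apply: eq_bigr => i _; rewrite mxE mulrDr. Qed.

Lemma dotpZr p a q : dotp p (a *: q) = a * dotp p q.
Proof. by rewrite mulr_sumr; apply: eq_bigr => i _; rewrite mxE mulrCA. Qed.

Lemma dotpBr p q q' : dotp p (q - q') = dotp p q - dotp p q'.
Proof. by rewrite dotpDr -scaleN1r dotpZr mulN1r. Qed.

Lemma dotpNl p q : dotp (- p) q = - dotp p q.
Proof. by rewrite -sumrN; apply: eq_bigr => i _; rewrite mxE mulNr. Qed.

(** Integration of the scalar product of p with the velocity, as an inequality on
    increments. *)
Lemma ac_dotp_increment_ge (y : R -> 'rV[R]_n) p (a b C : R) : a <= b ->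
  abs_continuous_on a b y ->
  {ae (@lebesgue_measure R), forall t, a < t < b ->
     exists2 dy, is_derive t 1 y dy & C <= dotp p dy} ->
  C * (b - a) <= dotp p (y b - y a).
Proof.
move=> ab acy aey; pose g t := C * t - dotp p (y t).
suff : g b <= g a by rewrite /g dotpBr; lra.
have n0 := norm1_ge0 p.
apply: ac_nonincreasing => //.
  apply: (@ac_dominated _ _ _ _ y y g a b (1 + `|C| + norm1 p)) => //.
    by have := normr_ge0 C; lra.
  move=> s t as_ st tb.
  have -> : g t - g s = C * (t - s) - dotp p (y t - y s) by rewrite /g dotpBr; ring.
  apply: le_trans (ler_normB _ _) _; rewrite normrM.
  have -> : `|t - s| = t - s by rewrite ger0_norm // subr_ge0.
  have := dotp_norm p (y t - y s); have := normr_ge0 (y t - y s); have := normr_ge0 C.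
  have ts0 : 0 <= t - s by rewrite subr_ge0.
  have : 0 <= norm1 p * (t - s) by rewrite mulr_ge0.
  have : 0 <= norm1 p * `|y t - y s| by rewrite mulr_ge0.
  have : 0 <= `|C| * `|y t - y s| by rewrite mulr_ge0.
  nra.
apply: ae_imply aey => t aet tab e e0.
have [dy dyt Cdy] := aet tab.
have e'0 : 0 < e / (norm1 p + 1) by rewrite divr_gt0//; lra.
have [r r0 Hr] := is_derive_straddle dyt e'0.
exists r => // s1 s2 s1ts2 s12 as1 s2b.
have s1s2 : 0 <= s2 - s1 by move/andP : s1ts2 => [h1 h2]; lra.
have {}Hr := Hr _ _ s1ts2 s12.
have -> : g s2 - g s1 = (C - dotp p dy) * (s2 - s1) - dotp p (y s2 - y s1 - (s2 - s1) *: dy).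
  by rewrite /g !dotpBr dotpZr; ring.
have h1 : (C - dotp p dy) * (s2 - s1) <= 0 by rewrite mulr_le0_ge0// subr_le0.
have h2 := dotp_norm p (y s2 - y s1 - (s2 - s1) *: dy).
have h3 : norm1 p * `|y s2 - y s1 - (s2 - s1) *: dy| <= norm1 p * (e / (norm1 p + 1) * (s2 - s1)).
  by rewrite ler_wpM2l.
have h4 : norm1 p * (e / (norm1 p + 1) * (s2 - s1)) <= e * (s2 - s1).
  have := e'0; set q := e / _ => q0.
  have qe : q * (norm1 p + 1) = e by rewrite divfK// gt_eqF//; lra.
  have : 0 <= q * (s2 - s1) by rewrite mulr_ge0// ltW.
  rewrite -qe; lra.
move: h2; rewrite ler_norml => /andP[h5 h6]; lra.
Qed.

Lemma is_derive_line (v : 'rV[R]_n -> R) (z e : 'rV[R]_n) (s : R) :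
  derivable v (z + s *: e) e ->
  is_derive s (1 : R) (fun s : R => v (z + s *: e)) ('D_e v (z + s *: e)).
Proof.
move=> dv.
have E : (fun h : R =>
    h^-1 *: (((fun s : R => v (z + s *: e)) \o shift s) (h *: (1 : R)) -
      v (z + s *: e))) =
  (fun h : R => h^-1 *: ((v \o shift (z + s *: e)) (h *: e) - v (z + s *: e))).
  by apply/funext => k; rewrite /= /shift /= scalerDl [k *: 1]mulr1 addrCA.
by apply: DeriveDef; rewrite /derivable /derive E.
Qed.

Lemma partial_mvt (v : 'rV[R]_n -> R) (i : 'I_n) (z : 'rV[R]_n) (s : R) :
  (forall x, derivable v x (delta_mx 0 i)) ->
  exists2 c : R, `|c| <= `|s| & v (z + s *: delta_mx 0 i) - v z =
    s * partial i v (z + c *: delta_mx 0 i).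
Proof.
move=> dv; set e := delta_mx 0 i.
pose g s := v (z + s *: e); pose dg s := partial i v (z + s *: e).
have g0 : g 0 = v z by rewrite /g scale0r addr0.
have der (x : R) : is_derive x (1 : R) g (dg x) by exact: is_derive_line.
have cg (a b : R) : {within `[a, b], continuous g}.
  apply: derivable_within_continuous => x _; exact: (@ex_derive _ _ _ _ _ _ _ (der x)).
rewrite -g0 -[v _]/(g s).
have [s0|s0|->] := ltgtP s 0; last by exists 0 => //; rewrite subrr mul0r.
- have [c] := MVT s0 (fun x _ => der x) (cg _ _).
  rewrite in_itv/= => /andP[sc c0] H; exists c.
    by rewrite !ltr0_norm// lerN2 ltW.
  by rewrite -[LHS]opprB H sub0r mulrN opprK mulrC.
- have [c] := MVT s0 (fun x _ => der x) (cg _ _).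
  rewrite in_itv/= => /andP[c0 cs] H; exists c.
    by rewrite !gtr0_norm// ltW.
  by rewrite H subr0 mulrC.
Qed.

(** Continuous partial derivatives give differentiability: the coordinates are
    changed one at a time, with the mean value theorem for each of them. *)
Lemma smooth_first_order (v : 'rV[R]_n -> R) x0 (e : R) : smooth v -> 0 < e ->
  exists2 eta : R, 0 < eta & forall x, `|x - x0| < eta ->
    `|v x - v x0 - dotp (gradient v x0) (x - x0)| <= e * `|x - x0|.
Proof.
move=> sv e0.
have dv i x : derivable v x (delta_mx 0 i) by have [_ ] := sv [::]; exact.
have cv i : continuous (partial i v) by have [] := sv [:: i].
have e'0 : 0 < e / n.+1%:R by rewrite divr_gt0.
have [eta eta0 Heta] : exists2 eta : R, 0 < eta & forall (i : 'I_n) x,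
    `|x - x0| < eta -> `|partial i v x - partial i v x0| <= e / n.+1%:R.
  exact: finite_family_equicontinuous.
exists eta => // x xx0.
(* z k has its first k coordinates from x and the others from x0 *)
pose z (k : nat) : 'rV[R]_n := \row_i (if (i < k)%N then x 0 i else x0 0 i).
have z0 : z 0%N = x0 by apply/rowP => i; rewrite mxE.
have zn : z n = x by apply/rowP => i; rewrite mxE ltn_ord.
have zS (i : 'I_n) : z i.+1 = z i + (x - x0) 0 i *: delta_mx 0 i.
  apply/rowP => j; rewrite !mxE eqxx/=; have [ji|] := eqVneq j i.
    by rewrite ji ltnSn ltnn mulr1 addrC subrK.
  rewrite -val_eqE/= ltnS leq_eqVlt => /negPf ->; by rewrite /= mulr0 addr0.
have -> : v x - v x0 = \sum_(i < n) (v (z i.+1) - v (z i)).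
  by rewrite -zn -{1}z0 -(big_mkord xpredT (fun i => v (z i.+1) - v (z i))) telescope_sumr.
rewrite -sumrB.
apply: le_trans (ler_norm_sum _ _ _) _.
apply: (@le_trans _ _ (\sum_(i < n) (e / n.+1%:R * `|x - x0|))).
  apply: ler_sum => i _; rewrite zS.
  have [c cs ->] := partial_mvt (z i) ((x - x0) 0 i) (dv i).
  have -> : gradient v x0 0 i = partial i v x0 by rewrite mxE.
  rewrite [partial i v x0 * _]mulrC -mulrBr normrM mulrC ler_pM//; last exact: coord_norm.
  apply: Heta; apply: le_lt_trans xx0.
  apply: norm_le_coord => // j; rewrite !mxE eqxx/=.
  have [->|ji] := eqVneq j i.
    rewrite ltnn mulr1 addrAC subrr add0r; apply: le_trans cs _; exact: coord_norm.
  rewrite mulr0 addr0; case: ifP => _; last by rewrite subrr normr0.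
  by have := coord_norm (x - x0) j; rewrite !mxE.
rewrite sumr_const card_ord -mulrnAl; apply: ler_wpM2r => //.
by rewrite -mulr_natr -mulrA ler_piMr ?(ltW e0)// mulrC ler_pdivrMr// mul1r ler_nat.
Qed.

End Dot.

Lemma expR_first_order (R : realType) (e : R) : 0 < e ->
  exists2 r : R, 0 < r & forall s, 0 <= s < r -> expR s - 1 - s <= e * s.
Proof.
move=> e0; have [r r0 Hr] := is_derive_straddle (is_derive_expR (0 : R)) e0.
exists r => // s /andP[s0 sr]; have := Hr 0 s; rewrite lexx s0 subr0 => /(_ isT sr).
rewrite expR0 [_ *: _]mulr1; apply: le_trans; exact: ler_norm.
Qed.

Lemma continuous_within_slices (R : realType) (V1 V2 V3 W : normedModType R)
    (A : set V2) (B : set V3) (g : V1 -> V2 -> V3 -> W) (x : V1) (u : V2) (d : V3) (e : R) :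
  {within [set z : V1 * (V2 * V3) | A z.2.1 /\ B z.2.2],
     continuous (fun z => g z.1 z.2.1 z.2.2)} ->
  A u -> B d -> 0 < e ->
  (\forall d' \near d, B d' -> `|g x u d' - g x u d| < e) /\
  (\forall u' \near u, A u' -> `|g x u' d - g x u d| < e).
Proof.
move=> cg Au Bd e0.
have /subspace_continuousP/(_ (x, (u, d)) (conj Au Bd)) := cg.
move/cvgrPdist_lt => /(_ e e0); rewrite near_withinE => Hn.
have /nbhs_ballP[r /= r0 Hr] := Hn.
split; apply/nbhs_ballP; exists r => //= z zr Bz; rewrite distrC.
  by apply: (Hr (x, (u, z))) => //; split => //=; [exact: ballxx|split => //=; exact: ballxx].
by apply: (Hr (x, (z, d))) => //; split => //=; [exact: ballxx|split => //=; exact: ballxx].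
Qed.

(** * Minimax values *)

Section MinMax.
Context {R : realType} {S T : Type} (A : set S) (B : set T) (F : S -> T -> R) (M : R).
Hypotheses (A0 : A !=set0) (B0 : B !=set0).
Hypothesis FM : forall a b, A a -> B b -> `|F a b| <= M.

Let has_inf_row a : A a -> has_inf [set F a b | b in B].
Proof.
move=> Aa; split; first by have [b Bb] := B0; exists (F a b), b.
exists (- M) => _ [b Bb <-]; by have := FM Aa Bb; rewrite ler_norml => /andP[].
Qed.

Let has_sup_row a : A a -> has_sup [set F a b | b in B].
Proof.
move=> Aa; split; first by have [b Bb] := B0; exists (F a b), b.
by exists M => _ [b Bb <-]; apply: le_trans (ler_norm _) (FM Aa Bb).
Qed.

Lemma supinf_gt c : c < sup [set inf [set F a b | b in B] | a in A] ->
  exists2 a, A a & forall b, B b -> c <= F a b.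
Proof.
move=> /sup_gt[|_ [a Aa <-] ca].
  by have [a Aa] := A0; exists (inf [set F a b | b in B]), a.
exists a => // b Bb; apply: le_trans (ltW ca) _.
by apply: ge_inf; [case: (has_inf_row Aa)|exists b].
Qed.

Lemma supinf_lt c : sup [set inf [set F a b | b in B] | a in A] < c ->
  forall a, A a -> exists2 b, B b & F a b < c.
Proof.
move=> H a Aa; have : inf [set F a b | b in B] < c.
  apply: le_lt_trans H; apply: ub_le_sup; last by exists a.
  exists M => _ [a' Aa' <-]; have [b Bb] := B0.
  apply: (@le_trans _ _ (F a' b)); last exact: le_trans (ler_norm _) (FM Aa' Bb).
  by apply: ge_inf; [case: (has_inf_row Aa')|exists b].
move=> /inf_lt[|_ [b Bb <-] Fc]; last by exists b.
by case: (has_inf_row Aa).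
Qed.

Lemma infsup_gt c : c < inf [set sup [set F a b | b in B] | a in A] ->
  forall a, A a -> exists2 b, B b & c < F a b.
Proof.
move=> H a Aa; have : c < sup [set F a b | b in B].
  apply: lt_le_trans H _; apply: ge_inf; last by exists a.
  exists (- M) => _ [a' Aa' <-]; have [b Bb] := B0.
  apply: (@le_trans _ _ (F a' b)).
    by have := FM Aa' Bb; rewrite ler_norml => /andP[].
  by apply: ub_le_sup; [case: (has_sup_row Aa')|exists b].
move=> /sup_gt[|_ [b Bb <-] Fc]; last by exists b.
by case: (has_sup_row Aa).
Qed.

Lemma infsup_lt c : inf [set sup [set F a b | b in B] | a in A] < c ->
  exists2 a, A a & forall b, B b -> F a b <= c.
Proof.
move=> /inf_lt[|_ [a Aa <-] ca].
  by have [a Aa] := A0; exists (sup [set F a b | b in B]), a.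
exists a => // b Bb; apply: le_trans (ltW ca).
by apply: ub_le_sup; [case: (has_sup_row Aa)|exists b].
Qed.

End MinMax.

(** * Local growth of the value along trajectories *)

Section Local.
Context {R : realType} {n m l : nat}.
Context (U : set 'rV[R]_m) (D : set 'rV[R]_l)
  (f : 'rV[R]_n -> 'rV[R]_m -> 'rV[R]_l -> 'rV[R]_n)
  (phi : 'rV[R]_n -> (R -> 'rV[R]_m) -> (R -> 'rV[R]_l) -> R -> 'rV[R]_n)
  (gamma : R).
Hypothesis bounds : forall r, exists M L, speed_bounds U D f r M L.
Hypothesis phi_flow : solution_flow U D f phi.
Hypothesis gamma_gt0 : 0 < gamma.
Notation flow := (flow phi).
Notation admissible := (admissible U D).
Notation disc t := (expR (- gamma * t)).

Lemma flow_speed x0 : exists dt M L, [/\ 0 < dt, 0 < M, 0 < L,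
  forall w t, admissible w -> 0 <= t <= dt -> `|flow x0 w t - x0| <= M * t &
  forall w t, admissible w -> 0 <= t <= dt ->
    `|f (flow x0 w t) (w.1 t) (w.2 t) - f x0 (w.1 t) (w.2 t)| <= L * (M * t)].
Proof.
have [dt sh] := short_time_exists bounds `|x0|.
have [dt0 [M [L [ML _ _]]]] := sh; have [M0 L0 fM fL] := ML.
have x0r : `|x0| <= `|x0| + 2 by rewrite lerDl.
have inr w t : admissible w -> 0 <= t <= dt -> `|flow x0 w t| <= `|x0| + 3.
  by move=> aw tdt; exact: (flow_stay_norm phi_flow sh x0r aw tdt).
have speed w t : admissible w -> 0 <= t <= dt -> `|flow x0 w t - x0| <= M * t.
  move=> aw /andP[t0 tdt]; rewrite -{2}(flow0 phi_flow x0 aw) -{2}[t]subr0.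
  apply: (trajectory_increment t0 (lexx 0) aw _ ML).
    exact: (flow_trajectory phi_flow).
  by move=> s /andP[s0 st]; apply: inr => //; rewrite s0 (le_trans st).
exists dt, M, L; split => // w t aw tdt.
have t0 : 0 <= t by case/andP: tdt.
apply: (@le_trans _ _ (L * `|flow x0 w t - x0|)).
  apply: fL; [exact: inr|lra| |].
    by have [[+ _] _] := aw; exact.
  by have [_ [+ _]] := aw; exact.
by rewrite ler_pM2l//; exact: speed.
Qed.

(** V is bounded below by its first-order expansion at x0, where p . f exceeds
    gamma V(x0) by theta.  Over a time tau this gives an increase of at least
    tau (gamma V(x0) + theta / 2), while discounting costs tau gamma V(x0) up to
    o(tau); what remains is a gain that is uniform over the controls. *)
Lemma local_increase (V : 'rV[R]_n -> R) x0 p theta :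
  (forall e : R, 0 < e -> exists2 eta : R, 0 < eta & forall x, `|x - x0| < eta ->
     V x0 + dotp p (x - x0) - e * `|x - x0| <= V x) ->
  0 < theta ->
  exists2 tau0 : R, 0 < tau0 & forall tau, 0 < tau <= tau0 ->
    exists2 c : R, V x0 < c & forall w, admissible w ->
      (forall t, 0 <= t -> gamma * V x0 + theta <= dotp p (f x0 (w.1 t) (w.2 t))) ->
      c <= disc tau * V (flow x0 w tau).
Proof.
move=> HV th0; set V0 := V x0.
have [dt [M [L [dt0 M0 L0 speed drift]]]] := flow_speed x0.
have e0 : 0 < theta / (4 * M) by rewrite divr_gt0//; lra.
have [eta eta0 Heta] := HV _ e0.
have aV0 : 0 <= `|V0| by [].
have gV0 : 0 < 4 * gamma * (`|V0| + 1) by rewrite !mulr_gt0// ltr_wpDl.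
have e20 : 0 < theta / (4 * gamma * (`|V0| + 1)) by rewrite divr_gt0.
have [rho rho0 Hrho] := expR_first_order e20.
have n0 := norm1_ge0 p.
pose K := norm1 p * (L * M).
have K0 : 0 <= K by rewrite mulr_ge0// mulr_ge0// ltW.
pose tau0 := Num.min (Num.min dt (eta / (2 * M)))
  (Num.min (theta / (4 * (K + 1))) (rho / (2 * gamma))).
exists tau0.
  by rewrite !lt_min dt0 /= !divr_gt0 ?mulr_gt0// ltr_wpDl.
move=> tau /andP[tau_gt0]; rewrite !le_min => /andP[/andP[tdt teta] /andP[tK trho]].
have {}teta : M * tau < eta.
  by move: teta; rewrite ler_pdivlMr; [lra|lra].
have {}tK : K * tau <= theta / 4.
  by move: tK; rewrite ler_pdivlMr; [lra|lra].
have {}trho : gamma * tau < rho.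
  have h : tau * (2 * gamma) <= rho by rewrite -ler_pdivlMr// mulr_gt0.
  have -> : gamma * tau = tau * (2 * gamma) / 2 by field.
  apply: le_lt_trans (_ : rho / 2 < rho); first by rewrite ler_pM2r ?invr_gt0.
  by rewrite ltr_pdivrMr// ltr_pMr// ltr1n.
pose X := V0 + (gamma * V0 + theta / 2) * tau.
have gt0 : 0 < gamma * tau by rewrite mulr_gt0.
exists (disc tau * X).
  have expE : disc tau * expR (gamma * tau) = 1.
    by rewrite -expRD mulNr addNr expR0.
  rewrite -[ltLHS]mul1r -expE -mulrA ltr_pM2l ?expR_gt0//.
  have h1 := Hrho (gamma * tau); rewrite trho ltW//= in h1; have {}h1 := h1 isT.
  have h2 := expR_ge1Dx (gamma * tau).
  have h3 : theta / (4 * gamma * (`|V0| + 1)) * (gamma * tau) * `|V0| <= theta / 4 * tau.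
    set q := theta / (4 * gamma * _).
    have qE : q * (4 * gamma * (`|V0| + 1)) = theta.
      by rewrite divfK// gt_eqF.
    have q0 : 0 <= q * (gamma * tau) by rewrite mulr_ge0// ltW.
    rewrite -qE; lra.
  have h4 : (expR (gamma * tau) - 1 - gamma * tau) * V0 <= theta / 4 * tau.
    apply: le_trans h3; apply: (@le_trans _ _ ((expR (gamma * tau) - 1 - gamma * tau) * `|V0|)).
      by rewrite ler_wpM2l ?ler_norm//; lra.
    by rewrite ler_wpM2r.
  have h5 : 0 < theta / 4 * tau by rewrite mulr_gt0// divr_gt0.
  rewrite /X; lra.
move=> w aw Hw; rewrite ler_pM2l ?expR_gt0//.
have tau1 : 0 <= tau <= dt by rewrite ltW.
have sp := speed w tau aw tau1.
have near : `|flow x0 w tau - x0| < eta by exact: le_lt_trans teta.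
apply: le_trans (Heta _ near).
have grow : (gamma * V0 + theta - K * tau) * (tau - 0) <= dotp p (flow x0 w tau - flow x0 w 0).
  have [ac0 ae0] := flow_trajectory phi_flow x0 tau (lexx 0) aw.
  apply: ac_dotp_increment_ge => //; first exact: ltW.
  apply: ae_imply ae0 => t H tt; exists (velocity f w t (flow x0 w t)); first exact: H.
  have t0 : 0 <= t by lra.
  have tt1 : 0 <= t <= dt by lra.
  have d1 := dotp_norm p (f (flow x0 w t) (w.1 t) (w.2 t) - f x0 (w.1 t) (w.2 t)).
  have d2 : norm1 p * `|f (flow x0 w t) (w.1 t) (w.2 t) - f x0 (w.1 t) (w.2 t)| <=
      norm1 p * (L * (M * t)).
    by rewrite ler_wpM2l// drift.
  have d3 : K * t <= K * tau by rewrite ler_wpM2l//; lra.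
  have d4 : norm1 p * (L * (M * t)) = K * t by rewrite /K !mulrA.
  have d5 := Hw t t0.
  move: d1; rewrite dotpBr ler_norml /velocity => /andP[d6 d7]; lra.
rewrite (flow0 phi_flow x0 aw) subr0 in grow.
have h1 : K * tau * tau <= theta / 4 * tau by rewrite ler_wpM2r// ltW.
have h2 : theta / (4 * M) * `|flow x0 w tau - x0| <= theta / 4 * tau.
  apply: (@le_trans _ _ (theta / (4 * M) * (M * tau))); first by rewrite ler_wpM2l// ltW.
  rewrite le_eqVlt; apply/orP; left; apply/eqP; field; lra.
rewrite /X -/V0; lra.
Qed.

(** The previous lemma for the opposites of V and p. *)
Lemma local_decrease (V : 'rV[R]_n -> R) x0 p theta :
  (forall e : R, 0 < e -> exists2 eta : R, 0 < eta & forall x, `|x - x0| < eta ->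
     V x <= V x0 + dotp p (x - x0) + e * `|x - x0|) ->
  0 < theta ->
  exists2 tau0 : R, 0 < tau0 & forall tau, 0 < tau <= tau0 ->
    exists2 c : R, c < V x0 & forall w, admissible w ->
      (forall t, 0 <= t -> dotp p (f x0 (w.1 t) (w.2 t)) <= gamma * V x0 - theta) ->
      disc tau * V (flow x0 w tau) <= c.
Proof.
move=> HV th0.
have [|tau0 tau00 H] := @local_increase (fun x => - V x) x0 (- p) theta _ th0.
  move=> e e0; have [eta eta0 Heta] := HV e e0; exists eta => // x /Heta.
  rewrite dotpNl; lra.
exists tau0 => // tau tt; have [c cV Hc] := H tau tt.
exists (- c); first by rewrite ltrNl.
move=> w aw Hw; rewrite lerNr -mulrN; apply: Hc => // t t0.
by rewrite dotpNl; have := Hw t t0; lra.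
Qed.

(** For short times the discounted obstacle stays near h x0, uniformly over the
    controls, so below V0. *)
Lemma local_obstacle (h : 'rV[R]_n -> R) Mh x0 (V0 : R) : (forall x, `|h x| <= Mh) ->
  locally_lipschitz h -> h x0 < V0 ->
  exists2 tau0 : R, 0 < tau0 & exists2 c : R, c < V0 &
    forall w t, admissible w -> 0 <= t <= tau0 -> disc t * h (flow x0 w t) <= c.
Proof.
move=> hM lh hV.
have Mh0 : 0 <= Mh by apply: le_trans (hM 0).
have [dt [M [L [dt0 M0 L0 speed _]]]] := flow_speed x0.
have [k [N /nbhs_ballP[r /= r0 rN] Hk]] := lh x0.
pose ka := (V0 - h x0) / 4.
have ka0 : 0 < ka by rewrite divr_gt0// subr_gt0.
have k0 : 0 <= `|k| by [].
pose tau0 := Num.min (Num.min dt (r / (2 * M)))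
  (Num.min (ka / (M * (`|k| + 1))) (ka / (gamma * (Mh + 1)))).
have Mk : 0 < M * (`|k| + 1) by rewrite mulr_gt0//; lra.
have gM : 0 < gamma * (Mh + 1) by rewrite mulr_gt0//; lra.
exists tau0; first by rewrite !lt_min dt0 /= !divr_gt0//; lra.
exists (h x0 + 2 * ka); first by rewrite /ka; lra.
move=> w t aw /andP[t0]; rewrite !le_min => /andP[/andP[tdt tr] /andP[tk tg]].
have {}tr : M * t < r by move: tr; rewrite ler_pdivlMr; lra.
have {}tk : M * t * (`|k| + 1) <= ka by move: tk; rewrite ler_pdivlMr//; lra.
have {}tg : gamma * t * (Mh + 1) <= ka by move: tg; rewrite ler_pdivlMr//; lra.
have sp := speed w t aw (introT andP (conj t0 tdt)).
have Nx0 : N x0 by apply: rN; exact: ballxx.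
have Ny : N (flow x0 w t).
  by apply: rN; rewrite -ball_normE /= distrC; exact: le_lt_trans tr.
have h1 : `|h (flow x0 w t) - h x0| <= k * `|flow x0 w t - x0|.
  exact: (Hk (_, _) (conj Ny Nx0)).
have h2 : k * `|flow x0 w t - x0| <= `|k| * (M * t).
  apply: (@le_trans _ _ (`|k| * `|flow x0 w t - x0|)).
    by rewrite ler_wpM2r// ler_norm.
  by rewrite ler_wpM2l.
have Mt : 0 <= M * t by rewrite mulr_ge0// ltW.
have gt : 0 <= gamma * t by rewrite mulr_ge0// ltW.
have h3 := expR_ge1Dx (- gamma * t).
have h4 := discount_le1 gamma_gt0 t0.
have := hM (flow x0 w t); rewrite ler_norml => /andP[h5 h6].
move: h1; rewrite ler_norml => /andP[h7 h8].
have h9 : (1 - disc t) * (- h (flow x0 w t)) <= (1 - disc t) * Mh.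
  by apply: ler_wpM2l; lra.
have h10 : (1 - disc t) * Mh <= gamma * t * Mh by apply: ler_wpM2r => //; lra.
lra.
Qed.

End Local.

(** * The viscosity inequalities *)

Section Touching.
Context {R : realType} {n : nat}.
Implicit Types V v : 'rV[R]_n -> R.

Lemma touching_below_first_order V v x0 : smooth v ->
  (\forall x \near x0, V x0 - v x0 <= V x - v x) ->
  forall e : R, 0 < e -> exists2 eta : R, 0 < eta & forall x, `|x - x0| < eta ->
     V x0 + dotp (gradient v x0) (x - x0) - e * `|x - x0| <= V x.
Proof.
move=> sv /nbhs_ballP[r /= r0 Hr] e e0.
have [eta eta0 Heta] := smooth_first_order x0 sv e0.
exists (Num.min r eta); first by rewrite lt_min r0.
move=> x; rewrite lt_min => /andP[xr /Heta].
have := Hr x; rewrite -ball_normE /= distrC => /(_ xr).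
by rewrite ler_norml => h1 /andP[h2 h3]; lra.
Qed.

Lemma touching_above_first_order V v x0 : smooth v ->
  (\forall x \near x0, V x - v x <= V x0 - v x0) ->
  forall e : R, 0 < e -> exists2 eta : R, 0 < eta & forall x, `|x - x0| < eta ->
     V x <= V x0 + dotp (gradient v x0) (x - x0) + e * `|x - x0|.
Proof.
move=> sv /nbhs_ballP[r /= r0 Hr] e e0.
have [eta eta0 Heta] := smooth_first_order x0 sv e0.
exists (Num.min r eta); first by rewrite lt_min r0.
move=> x; rewrite lt_min => /andP[xr /Heta].
have := Hr x; rewrite -ball_normE /= distrC => /(_ xr).
by rewrite ler_norml => h1 /andP[h2 h3]; lra.
Qed.

End Touching.

Lemma pointwise_strategy (R : realType) k j (A : set 'rV[R]_k) (B : set 'rV[R]_j)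
    (sg : 'rV[R]_k -> 'rV[R]_j) :
  (forall w, signals A w -> signals B (fun t => sg (w t))) ->
  strategies A B (fun a t => sg (a t)).
Proof.
move=> H; split => // s a1 a2 _ _ _; apply: ae_imply => t e1 tt; by rewrite e1.
Qed.

Section Viscosity.
Context {R : realType} {n m l : nat}.
Context (U : set 'rV[R]_m) (D : set 'rV[R]_l)
  (f : 'rV[R]_n -> 'rV[R]_m -> 'rV[R]_l -> 'rV[R]_n)
  (phi : 'rV[R]_n -> (R -> 'rV[R]_m) -> (R -> 'rV[R]_l) -> R -> 'rV[R]_n)
  (h : 'rV[R]_n -> R) (gamma Mh : R).
Hypotheses (cU : compact U) (cD : compact D).
Hypotheses (U0 : U !=set0) (D0 : D !=set0).
Hypothesis cf : {within [set z : 'rV[R]_n * ('rV[R]_m * 'rV[R]_l) | U z.2.1 /\ D z.2.2],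
   continuous (fun z => f z.1 z.2.1 z.2.2)}.
Hypothesis bounds : forall r, exists M L, speed_bounds U D f r M L.
Hypothesis phi_flow : solution_flow U D f phi.
Hypothesis hM : forall x, `|h x| <= Mh.
Hypothesis lh : locally_lipschitz h.
Hypothesis gamma_gt0 : 0 < gamma.
Notation flow := (flow phi).
Notation Vlow := (lower_value U D phi h gamma).
Notation Vup := (upper_value U D phi h gamma).

Lemma drift_bounded x p : exists M : R, forall u d, U u -> D d -> `|dotp p (f x u d)| <= M.
Proof.
have [M [L [M0 _ fM _]]] := bounds `|x|; exists (norm1 p * M) => u d Uu Dd.
apply: le_trans (dotp_norm _ _) _; rewrite ler_wpM2l//; first exact: norm1_ge0.
exact: fM.
Qed.

Lemma drift_near x p u d (e : R) : U u -> D d -> 0 < e ->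
  (\forall d' \near d, D d' -> `|dotp p (f x u d') - dotp p (f x u d)| < e) /\
  (\forall u' \near u, U u' -> `|dotp p (f x u' d) - dotp p (f x u d)| < e).
Proof.
move=> Uu Dd e0; have n1 : 0 < norm1 p + 1 by rewrite ltr_wpDl// norm1_ge0.
have e'0 : 0 < e / (norm1 p + 1) by rewrite divr_gt0.
have close y z : `|y - z| < e / (norm1 p + 1) -> `|dotp p y - dotp p z| < e.
  move=> yz; rewrite -dotpBr; apply: le_lt_trans (dotp_norm _ _) _.
  move: yz; rewrite ltr_pdivlMr//; have := normr_ge0 (y - z).
  have := norm1_ge0 p; lra.
have [h1 h2] := continuous_within_slices x cf Uu Dd e'0.
by split; [apply: filterS h1|apply: filterS h2] => z Hz Az; apply: close; exact: Hz.
Qed.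

(** Some constant d makes p . f large for all u, so that playing it raises
    discounted V above V(x0). *)
Lemma lower_value_supersolution :
  viscosity_supersolution gamma (lower_hamiltonian U D f) h Vlow.
Proof.
move=> v x0 sv touch; rewrite le_min; apply/andP; split; last first.
  by rewrite subr_ge0; exact: (obstacle_le_lower phi_flow hM gamma_gt0).
rewrite subr_ge0 leNgt; apply/negP; set p := gradient v x0.
set H := lower_hamiltonian _ _ _ _ _ => ltH.
pose theta := (H - gamma * Vlow x0) / 2.
have th0 : 0 < theta by rewrite divr_gt0// subr_gt0.
have [M FM] := drift_bounded x0 p.
have ltH' : gamma * Vlow x0 + theta < H by rewrite /theta; lra.
have [d Dd Hd] := supinf_gt D0 U0 (fun d u Dd Uu => FM u d Uu Dd) ltH'.
have [tau tau0 Htau] := local_increase bounds phi_flow gamma_gt0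
  (touching_below_first_order sv touch) th0.
have [c cV Hc] := Htau tau (introT andP (conj tau0 (lexx tau))).
suff : c <= Vlow x0 by rewrite leNgt cV.
have sd : signals D (fun=> d) by exact: signal_cst.
apply: (lower_dpp_ge bounds phi_flow hM gamma_gt0 U0 D0 (ltW tau0) sd) => u su.
apply: Hc => // t t0; apply: Hd; by have [+ _] := su; exact.
Qed.

(** Against each d some u makes p . f small, and a selection of such u is a
    strategy along which both V and the obstacle stay below V(x0) after
    discounting. *)
Lemma lower_value_subsolution :
  viscosity_subsolution gamma (lower_hamiltonian U D f) h Vlow.
Proof.
move=> v x0 sv touch; rewrite ge_min.
apply/orP; apply: contrapT => /not_orP[]; set p := gradient v x0.
set H := lower_hamiltonian _ _ _ _ _.
move=> /negP; rewrite -ltNge subr_gt0 => ltH /negP; rewrite -ltNge subr_gt0 => hV.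
pose theta := (gamma * Vlow x0 - H) / 2.
have th0 : 0 < theta by rewrite divr_gt0// subr_gt0.
have [M FM] := drift_bounded x0 p.
have ltH' : H < gamma * Vlow x0 - theta by rewrite /theta; lra.
have Hu := supinf_lt U0 (fun d u Dd Uu => FM u d Uu Dd) ltH'.
have [sg [Hsg msg]] : exists sg : 'rV[R]_l -> 'rV[R]_m,
    (forall d, D d -> U (sg d) /\ dotp p (f x0 (sg d) d) <= gamma * Vlow x0 - theta) /\
    (forall w, signals D w -> signals U (fun t => sg (w t))).
  apply: (finite_borel_selection (G := fun d u =>
    U u /\ dotp p (f x0 u d) <= gamma * Vlow x0 - theta)) => //.
  move=> d Dd; have [u Uu uc] := Hu d Dd; exists u => //.
  have e0 : 0 < gamma * Vlow x0 - theta - dotp p (f x0 u d) by rewrite subr_gt0.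
  have [+ _] := drift_near x0 p Uu Dd e0; apply: filterS => d' Hd' Dd'; split => //.
  by have := Hd' Dd'; rewrite ltr_norml; lra.
have [tau1 tau10 Htau] := local_decrease bounds phi_flow gamma_gt0
  (touching_above_first_order sv touch) th0.
have [tau2 tau20 [c2 c2V Hc2]] := local_obstacle bounds phi_flow gamma_gt0 hM lh hV.
pose tau := Num.min tau1 tau2.
have tau0 : 0 < tau by rewrite lt_min tau10.
have tt1 : 0 < tau <= tau1 by rewrite tau0 ge_min lexx.
have [c1 c1V Hc1] := Htau tau tt1.
suff : Vlow x0 <= Num.max c1 c2 by rewrite leNgt gt_max c1V c2V.
apply: (lower_dpp_le bounds phi_flow hM gamma_gt0 U0 D0 (ltW tau0)
  (pointwise_strategy msg)) => d sd.
have aw : admissible U D ((fun t => sg (d t)), d) by split => //=; exact: msg.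
split.
  move=> t /andP[t0 tt]; rewrite le_max; apply/orP; right; apply: Hc2 => //.
  by rewrite t0 (le_trans tt)// ge_min lexx orbT.
rewrite le_max; apply/orP; left; apply: Hc1 => // t t0.
by apply: (Hsg _ _).2; have [+ _] := sd; exact.
Qed.

(** The roles are exchanged: against each u some d makes p . f large, and d is
    played as a strategy. *)
Lemma upper_value_supersolution :
  viscosity_supersolution gamma (upper_hamiltonian U D f) h Vup.
Proof.
move=> v x0 sv touch; rewrite le_min; apply/andP; split; last first.
  by rewrite subr_ge0; exact: (obstacle_le_upper phi_flow hM gamma_gt0).
rewrite subr_ge0 leNgt; apply/negP; set p := gradient v x0.
set H := upper_hamiltonian _ _ _ _ _ => ltH.
pose theta := (H - gamma * Vup x0) / 2.
have th0 : 0 < theta by rewrite divr_gt0// subr_gt0.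
have [M FM] := drift_bounded x0 p.
have ltH' : gamma * Vup x0 + theta < H by rewrite /theta; lra.
have Hd := infsup_gt D0 FM ltH'.
have [sg [Hsg msg]] : exists sg : 'rV[R]_m -> 'rV[R]_l,
    (forall u, U u -> D (sg u) /\ gamma * Vup x0 + theta <= dotp p (f x0 u (sg u))) /\
    (forall w, signals U w -> signals D (fun t => sg (w t))).
  apply: (finite_borel_selection (G := fun u d =>
    D d /\ gamma * Vup x0 + theta <= dotp p (f x0 u d))) => //.
  move=> u Uu; have [d Dd dc] := Hd u Uu; exists d => //.
  have e0 : 0 < dotp p (f x0 u d) - (gamma * Vup x0 + theta) by rewrite subr_gt0.
  have [_ +] := drift_near x0 p Uu Dd e0; apply: filterS => u' Hu' Uu'; split => //.
  by have := Hu' Uu'; rewrite ltr_norml; lra.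
have [tau tau0 Htau] := local_increase bounds phi_flow gamma_gt0
  (touching_below_first_order sv touch) th0.
have [c cV Hc] := Htau tau (introT andP (conj tau0 (lexx tau))).
suff : c <= Vup x0 by rewrite leNgt cV.
apply: (upper_dpp_ge bounds phi_flow hM gamma_gt0 U0 D0 (ltW tau0)
  (pointwise_strategy msg)) => u su.
apply: Hc => [|t t0]; first by split => //=; exact: msg.
by apply: (Hsg _ _).2; have [+ _] := su; exact.
Qed.

(** Some constant u makes p . f small against all d. *)
Lemma upper_value_subsolution :
  viscosity_subsolution gamma (upper_hamiltonian U D f) h Vup.
Proof.
move=> v x0 sv touch; rewrite ge_min.
apply/orP; apply: contrapT => /not_orP[]; set p := gradient v x0.
set H := upper_hamiltonian _ _ _ _ _.
move=> /negP; rewrite -ltNge subr_gt0 => ltH /negP; rewrite -ltNge subr_gt0 => hV.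
pose theta := (gamma * Vup x0 - H) / 2.
have th0 : 0 < theta by rewrite divr_gt0// subr_gt0.
have [M FM] := drift_bounded x0 p.
have ltH' : H < gamma * Vup x0 - theta by rewrite /theta; lra.
have [u Uu Hu] := infsup_lt U0 D0 FM ltH'.
have [tau1 tau10 Htau] := local_decrease bounds phi_flow gamma_gt0
  (touching_above_first_order sv touch) th0.
have [tau2 tau20 [c2 c2V Hc2]] := local_obstacle bounds phi_flow gamma_gt0 hM lh hV.
pose tau := Num.min tau1 tau2.
have tau0 : 0 < tau by rewrite lt_min tau10.
have tt1 : 0 < tau <= tau1 by rewrite tau0 ge_min lexx.
have [c1 c1V Hc1] := Htau tau tt1.
suff : Vup x0 <= Num.max c1 c2 by rewrite leNgt gt_max c1V c2V.
have su : signals U (fun=> u) by exact: signal_cst.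
apply: (upper_dpp_le bounds phi_flow hM gamma_gt0 U0 D0 (ltW tau0) su) => d sd.
split.
  move=> t /andP[t0 tt]; rewrite le_max; apply/orP; right; apply: Hc2 => //.
  by rewrite t0 (le_trans tt)// ge_min lexx orbT.
rewrite le_max; apply/orP; left; apply: Hc1 => // t t0.
by apply: Hu; have [+ _] := sd; exact.
Qed.

End Viscosity.

Lemma locally_bounded_norm (R : realType) n (V : 'rV[R]_n -> R) (M : R) :
  (forall x, `|V x| <= M) -> [locally [bounded V x | x in setT]].
Proof.
move=> VM x _; exists M; split => [|B MB]; first exact: num_real.
by apply: nearW => y /= _; exact: le_trans (VM y) (ltW MB).
Qed.
Theorem theorem1 (R : realType) (n m l : nat)
  (U : set 'rV[R]_m) (D : set 'rV[R]_l)
  (f : 'rV[R]_n -> 'rV[R]_m -> 'rV[R]_l -> 'rV[R]_n)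
  (phi : 'rV[R]_n -> (R -> 'rV[R]_m) -> (R -> 'rV[R]_l) -> R -> 'rV[R]_n)
  (h : 'rV[R]_n -> R) (gamma : R)
  (U_compact : compact U) (U_nonempty : U !=set0)
  (D_compact : compact D) (D_nonempty : D !=set0)
  (f_continuous : {within [set z : 'rV[R]_n * ('rV[R]_m * 'rV[R]_l)
                          | U z.2.1 /\ D z.2.2],
                   continuous (fun z => f z.1 z.2.1 z.2.2)})
  (f_lipschitz : locally_lipschitz_uniformly U D f)
  (phi_flow : solution_flow U D f phi)
  (h_bounded : [bounded h x | x in setT])
  (h_lipschitz : locally_lipschitz h)
  (gamma_gt0 : 0 < gamma) :
  viscosity_solution gamma (lower_hamiltonian U D f) h
    (lower_value U D phi h gamma) /\
  viscosity_solution gamma (upper_hamiltonian U D f) h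
    (upper_value U D phi h gamma).
Proof.
have bounds r := speed_bounds_exist r U_compact D_compact f_continuous f_lipschitz.
have [Mh hM] : exists Mh : R, forall x, `|h x| <= Mh.
  have [M0 [_ HM]] := h_bounded; exists (M0 + 1) => x.
  by apply: (HM (M0 + 1)) => //; rewrite ltrDl.
split; split.
- by apply: locally_bounded_norm => x; apply: lower_value_norm; eassumption.
- exact: (lower_value_continuous bounds phi_flow hM).
- by apply: lower_value_supersolution; eassumption.
- by apply: lower_value_subsolution; eassumption.
- by apply: locally_bounded_norm => x; apply: upper_value_norm; eassumption.
- exact: (upper_value_continuous bounds phi_flow hM).
- by apply: upper_value_supersolution; eassumption.
- by apply: upper_value_subsolution; eassumption.
Qed.
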